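(* Let $G$ be a finite group acting linearly on a finite-dimensional complex vector space $V$. Let $I\subseteq\mathbb{R}$ be an open interval and $c:I\to V/\!\!/G=\sigma(V)\subseteq\mathbb{C}^n$ a curve of class $C^D$. Then there exists a global differentiable curve $\bar c:I\to V$ with $\sigma\circ\bar c=c$ if and only if $c$ is $1$-flat at every $t\in I$.
   Context: For a finite group $H$ acting linearly on a complex vector space $W$, choose a minimal system of homogeneous generators of $\mathbb{C}[W]^H$ and let $d(W,H)$ be the maximum of their degrees. Here $\sigma=(\sigma_1,\dots,\sigma_n)$ for a minimal system of homogeneous generators $\sigma_1,\dots,\sigma_n$ of $\mathbb{C}[V]^G$, and $V/\!\!/G$ is identified with $\sigma(V)$. Let $D$ be the maximum of $d(V,G_v)$ over all $v\in V$, where $G_v$ is the isotropy group of $v$ (for finite $G$ the slice representation at $v$ is $G_v$ acting on $V$). 1-flatness: let $t\in I$ and $v\in\sigma^{-1}(c(t))$. Let $\tau_1,\dots,\tau_m$ be a minimal system of homogeneous generators of $\mathbb{C}[V]^{G_v}$ with degrees $d'_1,\dots,d'_m$, and $\tau=(\tau_1,\dots,\tau_m):V\to\mathbb{C}^m$. By Luna's slice theorem there is a $G_v$-invariant open neighborhood $S$ of $0$ in $V$ such that $\tau(x)\mapsto\sigma(v+x)$ ($x\in S$) is a well-defined homeomorphism $\Phi$ from $\tau(S)$ onto an open neighborhood of $c(t)$ in $\sigma(V)$, with $\Phi(0)=c(t)$. The curve $c$ is $1$-flat at $t$ if, for $s$ near $t$, $\Phi^{-1}(c(s))=\big((s-t)^{d'_1}a_1(s),\dots,(s-t)^{d'_m}a_m(s)\big)$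 for some continuous functions $a_1,\dots,a_m$ defined near $t$. *)

(* Defs.v *)
From HB Require Import structures.
From mathcomp Require Import all_boot all_order all_algebra all_fingroup.
From mathcomp Require Import mxrepresentation.
From mathcomp Require Import complex.
From mathcomp Require Import all_classical all_reals topology normedtype derive.
From mathcomp Require mpoly.
Import (canonicals, coercions) mpoly.
Set Implicit Arguments.
Unset Strict Implicit.
Unset Printing Implicit Defensive.
Import Order.TTheory GRing.Theory Num.Theory numFieldNormedType.Exports.
Local Open Scope ring_scope.

(* The complex numbers are R[i] for a real field R : realType;
   V = C^N is modelled as row vectors 'rV[R[i]]_N, a group element g acting
   linearly by x |-> x *m rho g (rho a matrix representation of G). *)

Definition cabs {R : realType} (z : R[i]) : R :=
  Num.sqrt (complex.Re z ^+ 2 + complex.Im z ^+ 2).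

Definition vclose {R : realType} {k : nat} (e : R) (x y : 'rV[R[i]]_k) :=
  forall i, cabs (x 0 i - y 0 i) < e.

Definition vopen {R : realType} {k : nat} (S : set 'rV[R[i]]_k) :=
  forall x, S x -> exists2 e : R, 0 < e & forall y, vclose e y x -> S y.

Notation cpoly R N := (mpoly.mpoly N R[i]).

Definition pdeg {R : realType} {N : nat} (p : cpoly R N) : nat :=
  (mpoly.msize p).-1.

Definition is_homogeneous {R : realType} {N : nat} (p : cpoly R N) :=
  exists d, p \is mpoly.ishomog1 d (@mpoly.mdeg N).

(* p o A, i.e. the polynomial x |-> p (x *m A) *)
Definition poly_act {R : realType} {N : nat} (A : 'M[R[i]]_N) (p : cpoly R N)
  : cpoly R N :=
  mpoly.comp_mpoly
    [tuple \sum_(i < N) A i j *: mpoly.mpolyX R[i] (mpoly.mnm1 i) | j < N] p.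

Definition invariant {R : realType} {gT : finGroupType} {G : {group gT}}
  {N : nat} (rho : mx_representation R[i] G N) (H : {set gT}) (p : cpoly R N) :=
  forall g, g \in H -> poly_act (rho g) p = p.

Definition subst {R : realType} {N m : nat} (s : 'I_m -> cpoly R N)
  (q : cpoly R m) : cpoly R N :=
  mpoly.comp_mpoly [tuple s j | j < m] q.

(* s_1, ..., s_m is a minimal system of homogeneous generators of C[V]^H :
   homogeneous invariants generating the invariant algebra, none of which
   lies in the subalgebra generated by the others. *)
Definition min_hom_gen {R : realType} {gT : finGroupType} {G : {group gT}}
  {N : nat} (rho : mx_representation R[i] G N) (H : {set gT})
  (m : nat) (s : 'I_m -> cpoly R N) :=
  [/\ forall j, is_homogeneous (s j),
      forall j, invariant rho H (s j),
      forall p, invariant rho H p -> exists q, p = subst s q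
    & forall j, ~ exists q,
        s j = subst (fun k => if k == j then 0 else s k) q].

Definition isotropy {R : realType} {gT : finGroupType} {G : {group gT}}
  {N : nat} (rho : mx_representation R[i] G N) (v : 'rV[R[i]]_N) : {set gT} :=
  [set g in G | v *m rho g == v].

Definition polymap {R : realType} {N m : nat} (s : 'I_m -> cpoly R N)
  (x : 'rV[R[i]]_N) : 'rV[R[i]]_m :=
  \row_(j < m) mpoly.meval (fun k => x 0 k) (s j).

(* d(V, H) = d : some minimal system of homogeneous generators of C[V]^H has
   maximal degree d (this degree does not depend on the choice). *)
Definition dVH {R : realType} {gT : finGroupType} {G : {group gT}}
  {N : nat} (rho : mx_representation R[i] G N) (H : {set gT}) (d : nat) :=
  exists m (s : 'I_m -> cpoly R N),
    min_hom_gen rho H s /\ (\max_(j < m) pdeg (s j))%N = d.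

Definition is_D {R : realType} {gT : finGroupType} {G : {group gT}}
  {N : nat} (rho : mx_representation R[i] G N) (D : nat) :=
  (exists v, dVH rho (isotropy rho v) D) /\
  (forall v d, dVH rho (isotropy rho v) d -> (d <= D)%N).

Definition oitv {R : realType} (a b : \bar R) : set R :=
  fun t => (a < t%:E)%E /\ (t%:E < b)%E.

Definition Ck_on {R : realType} (I : set R) (k : nat) (f : R -> R) :=
  (forall j, (j < k)%N -> forall t, I t -> derivable (derive1n j f) t 1) /\
  (forall t, I t -> {for t, continuous (derive1n k f)}).

Definition curve_Ck {R : realType} {n : nat} (I : set R) (k : nat)
  (c : R -> 'rV[R[i]]_n) :=
  forall i, Ck_on I k (fun t => complex.Re (c t 0 i)) /\
            Ck_on I k (fun t => complex.Im (c t 0 i)).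

Definition curve_diff {R : realType} {N : nat} (I : set R)
  (c : R -> 'rV[R[i]]_N) :=
  forall i t, I t -> derivable (fun s => complex.Re (c s 0 i)) t 1 /\
                    derivable (fun s => complex.Im (c s 0 i)) t 1.

(* Luna slice data at v: S is a G_v-invariant open neighbourhood of 0 such that
   Phi : tau(x) |-> sigma(v + x) (x in S) is a well-defined homeomorphism
   from tau(S) onto an open neighbourhood of sigma(v) in sigma(V). *)
Definition luna_slice {R : realType} {gT : finGroupType} {G : {group gT}}
  {N n m : nat} (rho : mx_representation R[i] G N) (sigma : 'I_n -> cpoly R N)
  (v : 'rV[R[i]]_N) (tau : 'I_m -> cpoly R N) (S : set 'rV[R[i]]_N) :=
  [/\ vopen S, S 0,
      (forall g, g \in isotropy rho v -> forall x, S x -> S (x *m rho g)),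
      (* well defined and injective *)
      (forall x y, S x -> S y ->
         (polymap tau x = polymap tau y <-> polymap sigma (v + x) = polymap sigma (v + y)))
    & [/\
      (exists O : set 'rV[R[i]]_n, vopen O /\
         forall z, (exists2 x, S x & polymap sigma (v + x) = z) <->
                   (O z /\ exists w, polymap sigma w = z)),
      (forall x, S x -> forall e : R, 0 < e -> exists2 d : R, 0 < d &
         forall y, S y -> vclose d (polymap tau y) (polymap tau x) ->
           vclose e (polymap sigma (v + y)) (polymap sigma (v + x)))
    &
      (forall x, S x -> forall e : R, 0 < e -> exists2 d : R, 0 < d &
         forall y, S y -> vclose d (polymap sigma (v + y)) (polymap sigma (v + x)) ->
           vclose e (polymap tau y) (polymap tau x))]].

Definition one_flat_at {R : realType} {gT : finGroupType} {G : {group gT}}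
  {N n : nat} (rho : mx_representation R[i] G N) (sigma : 'I_n -> cpoly R N)
  (I : set R) (c : R -> 'rV[R[i]]_n) (t : R) :=
  forall v, polymap sigma v = c t ->
  forall m (tau : 'I_m -> cpoly R N), min_hom_gen rho (isotropy rho v) tau ->
  exists S, luna_slice rho sigma v tau S /\
  exists2 d : R, 0 < d &
  exists a : 'I_m -> R -> R[i],
    (forall j s, I s -> `|s - t| < d ->
        {for s, continuous (fun u => complex.Re (a j u))} /\
        {for s, continuous (fun u => complex.Im (a j u))}) /\
    (forall s, I s -> `|s - t| < d ->
       exists2 x, S x &
         polymap sigma (v + x) = c s /\
         polymap tau x = \row_(j < m) ((complex.Complex (s - t) 0) ^+ pdeg (tau j) * a j s)).

(* Main.v *)
(** A set-theoretic lift [f] of a curve that is 1-flat everywhere is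
    "differentiable modulo [G]": near [t] some translate of [f s] equals
    [f t + (s - t) w + o(s - t)]. Indeed homogeneity turns the normal form
    [(s - t)^d_j a_j(s)] into [tau (x(s) / (s - t)) = a(s)], and [tau] induces a
    homeomorphism from the orbit space onto its closed image. Such an [f] is
    turned into a differentiable lift by induction on the order of the group.
    Away from the parameters where [f] is fixed by the group the isotropy is
    smaller; at an accumulation point of these parameters value and derivative
    are both fixed, so every lift is differentiable there; at an isolated one
    the two one-sided derivatives of a lift lie in one orbit and can be matched
    by a group element. Conversely, the difference quotient [x(s) / (s - t)] of a
    differentiable lift is continuous, and [a = tau o (x / (s - t))]. The minimal
    systems of generators that 1-flatness quantifies over exist by Noether's
    finiteness theorem. *)

Require Import Defs.
From HB Require Import structures.
From mathcomp Require Import all_boot all_order all_algebra all_fingroup.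
From mathcomp Require Import mxrepresentation.
From mathcomp Require Import complex.
From mathcomp Require Import all_classical all_reals topology normedtype derive.
From mathcomp Require Import ring lra.
From mathcomp Require mpoly.
Import (canonicals, coercions) mpoly.
Set Implicit Arguments.
Unset Strict Implicit.
Unset Printing Implicit Defensive.
Import Order.TTheory GRing.Theory Num.Theory numFieldNormedType.Exports.
Local Open Scope ring_scope.

(** A lift chosen point by point has no regularity, so the hypothesis of the induction must not see
    the choice. Differentiability modulo the group is such a condition: the element [g] may depend
    wildly on [s], any other set-theoretic lift satisfies it too, and near a parameter with smaller
    isotropy it descends to the isotropy group. It only involves real scalars and a norm preserved
    by the group, hence the abstract setting of the lifting part. On the side of invariants
    everything rests on one estimate: if [tau y] is close to [tau x], then some translate of [y] is
    close to [x]. At equality it separates orbits; at [x = 0], combined with homogeneity, it bounds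
    preimages of bounded sets, so that the image is closed; applied to [sigma] at [v + x] and to
    [tau] at [x] it yields the slice theorem, with a small ball of an invariant norm as slice.
    Closedness is indispensable: 1-flatness gives [a(s)] as a value of [tau] only for [s <> t],
    while the derivative at [t] has to be a preimage of the limit [a(t)]. *)

Lemma cabsE (R : realType) (z : R[i]) : cabs z = Normc.normc z.
Proof. by case: z. Qed.

Lemma cabs_ge0 (R : realType) (z : R[i]) : 0 <= cabs z.
Proof. exact: sqrtr_ge0. Qed.

Lemma cabs0 (R : realType) : cabs (0 : R[i]) = 0.
Proof. by rewrite cabsE Normc.normc0. Qed.

Lemma cabs_eq0 (R : realType) (z : R[i]) : cabs z = 0 -> z = 0.
Proof. by rewrite cabsE; apply: Normc.eq0_normc. Qed.

Lemma cabsM (R : realType) (x y : R[i]) : cabs (x * y) = cabs x * cabs y.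
Proof. by rewrite !cabsE Normc.normcM. Qed.

Lemma cabsD (R : realType) (x y : R[i]) : cabs (x + y) <= cabs x + cabs y.
Proof. by rewrite !cabsE; apply: le_normcD. Qed.

Lemma cabsN (R : realType) (x : R[i]) : cabs (- x) = cabs x.
Proof. by rewrite !cabsE; apply: normcN. Qed.

Lemma cabsR (R : realType) (r : R) : cabs (r%:C)%C = `|r|.
Proof. by rewrite /cabs /= expr0n addr0 sqrtr_sqr. Qed.

Lemma cabsX (R : realType) (x : R[i]) k : cabs (x ^+ k) = cabs x ^+ k.
Proof.
elim: k => [|k IHk]; first by rewrite !expr0 cabsE Normc.normc1.
by rewrite !exprS cabsM IHk.
Qed.

Lemma cabs_prod (R : realType) (I : Type) (r : seq I) (P : pred I) (F : I -> R[i]) :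
  cabs (\prod_(i <- r | P i) F i) = \prod_(i <- r | P i) cabs (F i).
Proof.
apply: (big_morph (@cabs R)); first exact: cabsM.
by rewrite cabsE Normc.normc1.
Qed.

Lemma cabs_sum (R : realType) (I : Type) (r : seq I) (P : pred I) (F : I -> R[i]) :
  cabs (\sum_(i <- r | P i) F i) <= \sum_(i <- r | P i) cabs (F i).
Proof.
elim/big_rec2 : _ => [|i y x _ le_xy]; first by rewrite cabs0.
by apply: le_trans (cabsD _ _) _; rewrite lerD2l.
Qed.

Lemma ler_Re_cabs (R : realType) (z : R[i]) : `|complex.Re z| <= cabs z.
Proof. by rewrite -sqrtr_sqr ler_sqrt ?lerDl ?sqr_ge0 // addr_ge0 ?sqr_ge0. Qed.

Lemma ler_Im_cabs (R : realType) (z : R[i]) : `|complex.Im z| <= cabs z.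
Proof. by rewrite -sqrtr_sqr ler_sqrt ?lerDr ?sqr_ge0 // addr_ge0 ?sqr_ge0. Qed.

Lemma cabs_ReIm (R : realType) (z : R[i]) :
  cabs z <= `|complex.Re z| + `|complex.Im z|.
Proof.
case: z => x y; rewrite /cabs /= -[leRHS]ger0_norm ?addr_ge0 // -sqrtr_sqr.
rewrite ler_sqrt ?sqr_ge0 // sqrrD !real_normK ?num_real //.
by rewrite -addrA lerD2l lerDr mulrn_wge0 // mulr_ge0.
Qed.

(** * Norms invariant under the group *)

Section InvariantNorm.

Variables (R : realType) (gT : finGroupType) (G : {group gT}) (N : nat).
Variable rho : mx_representation R[i] G N.

Implicit Types (x y : 'rV[R[i]]_N) (g h : gT).

Definition vnorm (k : nat) (x : 'rV[R[i]]_k) : R := \sum_i cabs (x 0 i).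

(** Summing over the group turns its elements into isometries, so that error estimates survive a
    translation of the lift. *)
Definition inorm (x : 'rV[R[i]]_N) : R := \sum_(g in G) vnorm (x *m rho g).

Lemma vnorm_ge0 k (x : 'rV[R[i]]_k) : 0 <= vnorm x.
Proof. by apply: sumr_ge0 => i _; apply: cabs_ge0. Qed.

Lemma vnormD k (x y : 'rV[R[i]]_k) : vnorm (x + y) <= vnorm x + vnorm y.
Proof. by rewrite -big_split; apply: ler_sum => i _; rewrite mxE cabsD. Qed.

Lemma vnormN k (x : 'rV[R[i]]_k) : vnorm (- x) = vnorm x.
Proof. by apply: eq_bigr => i _; rewrite mxE cabsN. Qed.

Lemma vnormZ k c (x : 'rV[R[i]]_k) : vnorm (c *: x) = cabs c * vnorm x.
Proof. by rewrite mulr_sumr; apply: eq_bigr => i _; rewrite mxE cabsM. Qed.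

Lemma cabs_le_vnorm k (x : 'rV[R[i]]_k) i : cabs (x 0 i) <= vnorm x.
Proof.
rewrite /vnorm (bigD1 i) //= lerDl.
by apply: sumr_ge0 => j _; apply: cabs_ge0.
Qed.

Lemma vnorm_mulmx k l (A : 'M[R[i]]_(k, l)) : exists2 C : R, 0 < C &
  forall x : 'rV[R[i]]_k, vnorm (x *m A) <= C * vnorm x.
Proof.
exists (1 + \sum_j \sum_i cabs (A i j)).
  by rewrite ltr_pwDl // sumr_ge0 // => j _; apply: sumr_ge0 => i _; apply: cabs_ge0.
move=> x; apply: (@le_trans _ _ ((\sum_j \sum_i cabs (A i j)) * vnorm x)); last first.
  by rewrite ler_wpM2r ?vnorm_ge0 // lerDr.
rewrite mulr_suml; apply: ler_sum => j _; rewrite mxE.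
apply: le_trans (cabs_sum _ _ _) _; rewrite mulr_suml; apply: ler_sum => i _.
by rewrite cabsM mulrC ler_wpM2l ?cabs_ge0 // cabs_le_vnorm.
Qed.

Lemma repr_actM x g h : g \in G -> h \in G -> x *m rho g *m rho h = x *m rho (g * h)%g.
Proof. by move=> Gg Gh; rewrite repr_mxM // mulmxA. Qed.

Lemma repr_act1 x : x *m rho 1%g = x.
Proof. by rewrite repr_mx1 mulmx1. Qed.

Lemma inorm_act g x : g \in G -> inorm (x *m rho g) = inorm x.
Proof.
move=> Gg; rewrite /inorm [RHS](reindex_inj (mulgI g)) /=.
by apply: eq_big => [h|h Gh]; rewrite ?groupMl // repr_actM.
Qed.

Lemma inorm_ge0 x : 0 <= inorm x.
Proof. by apply: sumr_ge0 => g _; apply: vnorm_ge0. Qed.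

Lemma inormD x y : inorm (x + y) <= inorm x + inorm y.
Proof. by rewrite -big_split; apply: ler_sum => g _; rewrite mulmxDl vnormD. Qed.

Lemma inormN x : inorm (- x) = inorm x.
Proof. by apply: eq_bigr => g _; rewrite mulNmx vnormN. Qed.

Lemma inormB x y : inorm (x - y) = inorm (y - x).
Proof. by rewrite -opprB inormN. Qed.

Lemma inormZ (r : R) x : inorm ((r%:C)%C *: x) = `|r| * inorm x.
Proof.
by rewrite mulr_sumr; apply: eq_bigr => g _; rewrite -scalemxAl vnormZ cabsR.
Qed.

Lemma vnorm_le_inorm x : vnorm x <= inorm x.
Proof.
rewrite /inorm (bigD1 1%g) //= repr_act1 lerDl.
by apply: sumr_ge0 => g _; apply: vnorm_ge0.
Qed.

Lemma cabs_le_inorm x i : cabs (x 0 i) <= inorm x.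
Proof. exact: le_trans (cabs_le_vnorm _ _) (vnorm_le_inorm _). Qed.

Lemma inorm0 : inorm 0 = 0.
Proof. by rewrite -(scale0r 0) (inormZ 0) normr0 mul0r. Qed.

Lemma inorm_eq0 x : inorm x = 0 -> x = 0.
Proof.
move=> x0; apply/rowP => i; rewrite mxE; apply: cabs_eq0; apply/eqP.
by rewrite eq_le cabs_ge0 -x0 cabs_le_inorm.
Qed.

Lemma inorm_gt0 x : x <> 0 -> 0 < inorm x.
Proof.
move=> x0; rewrite lt0r inorm_ge0 andbT; apply/eqP => /inorm_eq0; exact: x0.
Qed.

Lemma inorm_le_vnorm : exists2 K : R, 0 < K & forall x, inorm x <= K * vnorm x.
Proof.
pose C g := sval (cid2 (vnorm_mulmx (rho g))).
have C_gt0 g : 0 < C g by rewrite /C; case: cid2.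
have C_le g x : vnorm (x *m rho g) <= C g * vnorm x by rewrite /C; case: cid2.
exists (1 + \sum_(g in G) C g).
  by rewrite ltr_pwDl // sumr_ge0 // => g _; apply: ltW.
move=> x; apply: (@le_trans _ _ ((\sum_(g in G) C g) * vnorm x)); last first.
  by rewrite ler_wpM2r ?vnorm_ge0 // lerDr.
by rewrite mulr_suml; apply: ler_sum => g _.
Qed.

Lemma vclose_vnorm k (x y : 'rV[R[i]]_k) e : vnorm (x - y) < e -> vclose e x y.
Proof.
move=> xy i; apply: le_lt_trans xy.
by have := cabs_le_vnorm (x - y) i; rewrite !mxE.
Qed.

Lemma vnorm_vclose k (x y : 'rV[R[i]]_k) e : vclose e x y -> vnorm (x - y) <= k%:R * e.
Proof.
move=> xy; rewrite mulr_natl -[k in leRHS]card_ord -sumr_const.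
by apply: ler_sum => i _; rewrite !mxE ltW.
Qed.

Lemma inorm_vclose : exists2 K : R, 0 < K &
  forall x y e, 0 < e -> vclose e x y -> inorm (x - y) <= K * e.
Proof.
have [K K0 HK] := inorm_le_vnorm; exists (K * (N%:R + 1)).
  by rewrite mulr_gt0 // ltr_pwDr.
move=> x y e e0 xy; rewrite -mulrA; apply: le_trans (HK _) _.
rewrite ler_wpM2l ?(ltW K0) //; apply: le_trans (vnorm_vclose xy) _.
by rewrite ler_wpM2r ?(ltW e0) // lerDl.
Qed.

End InvariantNorm.

(** * Uniform radii and connectedness *)

Lemma finite_radius (R : realType) (T : finType) (P : T -> R -> Prop) :
  (forall t d d', 0 < d' <= d -> P t d -> P t d') ->
  (forall t, exists2 d, 0 < d & P t d) ->
  exists2 d, 0 < d & forall t, P t d.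
Proof.
move=> Pdown Pex; pose r t := sval (cid2 (Pex t)).
have r_gt0 t : 0 < r t by rewrite /r; case: cid2.
have Pr t : P t (r t) by rewrite /r; case: cid2.
(* The neutral value [1] keeps the minimum positive even for an empty type. *)
have d_gt0 : 0 < \big[Num.min/1]_t r t by apply: lt_bigmin.
exists (\big[Num.min/1]_t r t) => // t.
by apply: (Pdown t (r t)) => //; rewrite d_gt0 bigmin_le_cond.
Qed.

Lemma locally_constant (R : realType) (J : set R) (P : R -> Prop) :
  is_interval J ->
  (forall s, J s -> exists2 d : R, 0 < d &
     forall s', J s' -> `|s' - s| < d -> (P s <-> P s')) ->
  forall s s', J s -> J s' -> P s -> P s'.
Proof.
move=> /connected_intervalP Jc Pl s s' Js Js' Ps.
(* [U Q] is the union of the balls of constancy around the points of [J] where [Q] holds. Thus the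
   locus of [P] in [J] is the trace of the open set [U P] and of the closed complement of [U (~ P)],
   and connectedness applies. *)
pose U (Q : R -> Prop) := [set x | exists2 u, J u /\ Q u & exists2 d, 0 < d &
  (forall s', J s' -> `|s' - u| < d -> (P u <-> P s')) /\ `|x - u| < d]%classic.
have Uo Q : open (U Q).
  rewrite openE => x [u Qu [d d0 [Pd xd]]]; rewrite /interior.
  apply/nbhs_ballP; exists (d - `|x - u|) => /=; first by rewrite subr_gt0.
  move=> y; rewrite /ball /= => xy; exists u => //; exists d => //; split=> //.
  by rewrite distrC in xy; have := ler_distD x y u; lra.
have JP : (J `&` P)%classic = J.
  apply: Jc; first by exists s.
  - exists (U P) => //; apply/seteqP; split=> x [Jx].
    move=> Px; split=> //; exists x => //; have [d d0 Hd] := Pl x Jx.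
    by exists d => //; split=> //; rewrite subrr normr0.
  by move=> [u [Ju Pu] [d d0 [Hd xu]]]; split=> //; apply/Hd.
  - exists (~` U (fun x => ~ P x))%classic; first exact: open_closedC.
  apply/seteqP; split=> x [Jx].
    by move=> Px; split=> // -[u [Ju nPu] [d d0 [Hd xu]]]; apply: nPu; apply/(Hd x).
  move=> nU; split=> //; apply: contrapT => nPx; apply: nU; exists x => //.
  have [d d0 Hd] := Pl x Jx.
  by exists d => //; split=> //; rewrite subrr normr0.
by move: Js'; rewrite -JP => -[].
Qed.

(** * Lifting curves that are differentiable modulo a finite group *)

Section DifferentiableLift.

Variables (R : realType) (gT : finGroupType) (G : {group gT}) (V : lmodType R).
Variables (nrm : V -> R) (act : V -> gT -> V).
Hypothesis nrmD : forall x y, nrm (x + y) <= nrm x + nrm y.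
Hypothesis nrmZ : forall r x, nrm (r *: x) = `|r| * nrm x.
Hypothesis nrm_eq0 : forall x, nrm x = 0 -> x = 0.
Hypothesis act_linear : forall g, linear (act^~ g).
Hypothesis act1 : forall x, act x 1%g = x.
Hypothesis actM : forall x g h, g \in G -> h \in G -> act (act x g) h = act x (g * h)%g.
Hypothesis nrm_act : forall g x, g \in G -> nrm (act x g) = nrm x.

Implicit Types (H : {group gT}) (I J : set R) (f F : R -> V) (v w x y : V) (d e r : R).

Let nrm0 : nrm 0 = 0.
Proof. by rewrite -(scale0r 0) nrmZ normr0 mul0r. Qed.

Let nrmN x : nrm (- x) = nrm x.
Proof. by rewrite -scaleN1r nrmZ normrN normr1 mul1r. Qed.

Let nrmBC x y : nrm (x - y) = nrm (y - x).
Proof. by rewrite -opprB nrmN. Qed.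

Let nrm_ge0 x : 0 <= nrm x.
Proof. by have := nrmD x (- x); rewrite subrr nrm0 nrmN; lra. Qed.

Let nrm_gt0 x : x <> 0 -> 0 < nrm x.
Proof. by move=> x0; rewrite lt0r nrm_ge0 andbT; apply/eqP => /nrm_eq0. Qed.

Let nrm_tri x y z : nrm (x - z) <= nrm (x - y) + nrm (y - z).
Proof. by rewrite -[x in leLHS](subrK y) -addrA nrmD. Qed.

Let act0 g : act 0 g = 0.
Proof. by have := act_linear g (-1) 0 0; rewrite scaler0 addr0 scaleN1r addNr. Qed.

Let actZ r x g : act (r *: x) g = r *: act x g.
Proof. by rewrite -[_ *: x in LHS]addr0 act_linear act0 addr0. Qed.

Let actB x y g : act (x - y) g = act x g - act y g.
Proof. by rewrite addrC -scaleN1r act_linear scaleN1r addrC. Qed.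

Let actKV x g : g \in G -> act (act x g) g^-1%g = x.
Proof. by move=> Gg; rewrite actM ?groupV // mulgV act1. Qed.

Definition ropen J := forall t, J t ->
  exists2 d : R, 0 < d & forall s, `|s - t| < d -> J s.

(** No regularity of [g] in [s] is asked for: the values [f s] with [s <> t] enter only through
    their orbits. *)
Definition diff_mod (H : {set gT}) J f t w := forall e : R, 0 < e ->
  exists2 d : R, 0 < d & forall s, J s -> `|s - t| < d ->
  exists2 g, g \in H & nrm (act (f s) g - f t - (s - t) *: w) <= e * `|s - t|.

(** The value [v] is separate from [F t] so that the expansion makes sense at a boundary point [t]
    outside [J]. *)
Definition has_jet J F t v w := forall e : R, 0 < e ->
  exists2 d : R, 0 < d & forall s, J s -> `|s - t| < d ->
  nrm (F s - v - (s - t) *: w) <= e * `|s - t|.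

Definition lift_on (H : {set gT}) J f F :=
  forall t, J t -> exists2 g, g \in H & F t = act (f t) g.

Definition diff_lift (H : {set gT}) J f F := lift_on H J f F /\
  forall t, J t -> exists w, has_jet J F t (F t) w.

Lemma has_jet_continuous J F t v w : has_jet J F t v w ->
  forall e : R, 0 < e -> exists2 d : R, 0 < d &
    forall s, J s -> `|s - t| < d -> nrm (F s - v) <= e.
Proof.
move=> Fv e e0; have [d d0 Hd] := Fv 1 ltr01.
have C0 : 0 < 1 + nrm w by have := nrm_ge0 w; lra.
exists (Num.min d (e / (1 + nrm w))); first by rewrite lt_min d0 divr_gt0.
move=> s Js; rewrite lt_min => /andP[sd]; rewrite ltr_pdivlMr // mulrDr mulr1 => se.
have := Hd s Js sd; rewrite mul1r.
have := nrmD (F s - v - (s - t) *: w) ((s - t) *: w).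
rewrite subrK nrmZ; lra.
Qed.

(** If the values differ, the distance stays away from [0] for small [r]; if only the derivatives
    differ, it is a positive multiple of [|r|]. As there are finitely many pairs, one [d] can serve
    both as radius and as slope. *)
Lemma orbit_gap v w : exists2 d : R, 0 < d & forall g h,
  act v g <> act v h \/ act w g <> act w h -> forall r : R, `|r| < d ->
  d * `|r| <= nrm ((act v g + r *: (act w g)) - (act v h + r *: (act w h))).
Proof.
suff [d d0 Hd] : exists2 d : R, 0 < d & forall gh : gT * gT,
    act v gh.1 <> act v gh.2 \/ act w gh.1 <> act w gh.2 ->
    forall r : R, `|r| < d -> d * `|r| <= nrm ((act v gh.1 - act v gh.2) +
      r *: (act w gh.1 - act w gh.2)).
  exists d => // g h ne r rd; have := Hd (g, h) ne r rd => /=.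
  by rewrite scalerBr opprD addrACA.
apply: finite_radius => [[g h] d d' /andP[d'0 dd'] /= Hd ne r rd | [g h] /=].
  apply: le_trans (Hd ne r (lt_le_trans rd dd')).
  by rewrite ler_wpM2r.
set A := act v _ - _; set B := act w _ - _.
have [A0|A0] := eqVneq A 0.
  have [B0|/eqP B0] := eqVneq B 0.
    exists 1 => // -[]; first by move/eqP: A0; rewrite subr_eq0 => /eqP.
    by move/eqP: B0; rewrite subr_eq0 => /eqP.
  exists (nrm B); first exact: nrm_gt0.
  by move=> _ r _; rewrite A0 add0r nrmZ mulrC.
move/eqP: A0 => /nrm_gt0 A0; have B0 := nrm_ge0 B.
have B1 : 0 < 1 + nrm B by lra.
exists (Num.min 1 (nrm A / (1 + nrm B))); first by rewrite lt_min ltr01 divr_gt0.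
move=> _ r; set d := Num.min _ _; rewrite lt_min => /andP[r1].
rewrite ltr_pdivlMr // mulrDr mulr1 => rA.
have dr : d * `|r| <= `|r| by rewrite -[leRHS]mul1r ler_wpM2r // ge_min lexx.
have := nrmD (A + r *: B) (- (r *: B)); rewrite addrK nrmN nrmZ.
lra.
Qed.

(** If [g] brings [f s] near the expansion at [t] and [F s] is the translate of [f s] by [k], then
    the isometry [g^-1 * k] carries the estimate over to [F s]; the expansion is moved by an element
    depending on [s]. *)
Lemma lift_diff_mod H J I f F t w : H \subset G -> (forall s, J s -> I s) ->
  diff_mod H I f t w -> lift_on H J f F ->
  forall e : R, 0 < e -> exists2 d : R, 0 < d & forall s, J s -> `|s - t| < d ->
  exists2 h, h \in H &
    nrm (F s - (act (f t) h + (s - t) *: (act w h))) <= e * `|s - t|.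
Proof.
move=> /fintype.subsetP sHG JI fw Ff e e0; have [d d0 Hd] := fw e e0.
exists d => // s Js sd; have [g Hg Hge] := Hd s (JI s Js) sd.
have [k Hk ->] := Ff s Js.
exists (g^-1 * k)%g; first by rewrite groupM ?groupV.
have Gg := sHG _ Hg; have Gk := sHG _ Hk; have Ggk : (g^-1 * k)%g \in G.
  by rewrite groupM ?groupV.
move: Hge; rewrite -(nrm_act _ Ggk) !actB actZ.
by rewrite actM // mulKVg opprD addrA.
Qed.

(* The candidates [(f b + (s - b) w) h] for the first order expansion at [b]
   are at distances comparable to [|s - b|], so that by connectedness a
   continuous lift stays close to one of them. *)
Lemma one_sided_jet H J I f F b w : H \subset G -> is_interval J ->
  (forall s, J s -> I s) -> ~ J b -> diff_mod H I f b w -> diff_lift H J f F ->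
  exists2 h, h \in H & has_jet J F b (act (f b) h) (act w h).
Proof.
move=> sHG Jint JI nJb fw [Ff Fd].
have near_b := lift_diff_mod sHG JI fw Ff.
have [eta eta0 gap] := orbit_gap (f b) w.
(* Candidates are [eta |s - b|] apart. Being within [e0 |s - b|] of one and strictly within
   [3 e0 |s - b|] of another, with [e0 = eta / 4], forces them to coincide. *)
have e00 : 0 < eta / 4 by lra.
set e0 := eta / 4 in e00.
have [d1 d10 Hd1] := near_b e0 e00.
set d0 := Num.min d1 eta; have d00 : 0 < d0 by rewrite lt_min d10.
have [[s0 [Js0 s0d]]|none] := pselect (exists s, J s /\ `|s - b| < d0); last first.
  exists 1%g => //; move=> e _; exists d0 => // s Js sd; case: none.
  by exists s.
have d0P s : `|s - b| < d0 -> `|s - b| < d1 /\ `|s - b| < eta.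
  by rewrite lt_min => /andP.
have [h0 Hh0 Hs0] := Hd1 s0 Js0 (d0P _ s0d).1.
have bJ s : J s -> 0 < `|s - b|.
  by move=> Js; rewrite normr_gt0 subr_eq0; apply/eqP => sb; apply: nJb; rewrite -sb.
pose X h s := act (f b) h + (s - b) *: (act w h).
have jump s h : J s -> `|s - b| < d0 -> nrm (F s - X h s) <= e0 * `|s - b| ->
    nrm (F s - X h0 s) < 3 * e0 * `|s - b| ->
    act (f b) h = act (f b) h0 /\ act w h = act w h0.
  move=> Js sd Hh Hh0s; have u0 := bJ s Js.
  apply: contrapT => ne; have := gap h h0 _ (s - b) (d0P _ sd).2.
  have: act (f b) h <> act (f b) h0 \/ act w h <> act w h0.
    have [?|?] := pselect (act (f b) h = act (f b) h0); last by left.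
    by right=> ?; apply: ne.
  move=> ne' /(_ ne'); rewrite -/(X h s) -/(X h0 s).
  have := nrm_tri (X h s) (F s) (X h0 s); rewrite (nrmBC (X h s) (F s)).
  by rewrite /e0 in Hh Hh0s *; lra.
(* Closeness to [X h0] is locally constant: on the chosen step [F] and [X h0] together move by at
   most [e0 |s - b| / 2] and [|s - b|] changes by at most an eighth, so the bound at one end gives
   less than [3 e0] at the other, which [jump] improves to [e0]. *)
have stay s : J s -> `|s - b| < d0 -> nrm (F s - X h0 s) <= e0 * `|s - b|.
  move=> Js sd.
  pose P s := nrm (F s - X h0 s) <= e0 * `|s - b|.
  pose J0 := [set s | J s /\ `|s - b| < d0]%classic.
  have J0int : is_interval J0.
    move=> x y [Jx xd] [Jy yd] z xzy; split; first exact: Jint xzy.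
    move: xd yd; rewrite !ltr_norml; lra.
  apply: (@locally_constant _ J0 P J0int _ s0 s) => //= {s Js sd} s [Js sd].
  have u0 := bJ s Js; have [ws Hws] := Fd s Js.
  have eu0 : 0 < e0 * `|s - b| / 4 by rewrite divr_gt0 // mulr_gt0.
  have [d2 d20 Hd2] := has_jet_continuous Hws eu0.
  set W := nrm (act w h0); have W0 : 0 <= W by apply: nrm_ge0.
  have W1 : 0 < 1 + W by lra.
  pose d := Num.min d2 (Num.min (`|s - b| / 8) (e0 * `|s - b| / 4 / (1 + W))).
  exists d; first by rewrite !lt_min d20 !divr_gt0 // mulr_gt0.
  move=> s' [Js' s'd]; rewrite !lt_min => /and3P[sd2 sd8]; rewrite ltr_pdivlMr // => sW.
  have Fss := Hd2 s' Js' sd2.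
  have Xss : nrm (X h0 s' - X h0 s) <= e0 * `|s - b| / 4.
    have -> : X h0 s' - X h0 s = (s' - s) *: (act w h0).
      by rewrite /X opprD addrACA subrr add0r -scalerBl opprB addrA subrK.
    by rewrite nrmZ -/W; have := normr_ge0 (s' - s); nra.
  have Q1 : nrm (F s' - X h0 s') <= nrm (F s - X h0 s) + e0 * `|s - b| / 2.
    have := nrm_tri (F s') (F s) (X h0 s').
    have := nrm_tri (F s) (X h0 s) (X h0 s').
    rewrite (nrmBC (X h0 s) (X h0 s')); lra.
  have Q2 : nrm (F s - X h0 s) <= nrm (F s' - X h0 s') + e0 * `|s - b| / 2.
    have := nrm_tri (F s) (F s') (X h0 s).
    have := nrm_tri (F s') (X h0 s') (X h0 s).
    rewrite (nrmBC (F s) (F s')); lra.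
  have u1 : `|s' - b| <= `|s - b| + `|s - b| / 8.
    by have := ler_distD s s' b; lra.
  have u2 : `|s - b| <= `|s' - b| + `|s - b| / 8.
    by have := ler_distD s' s b; rewrite (distrC s s'); lra.
  split=> Ps; rewrite /P.
    have [h Hh Hhs] := Hd1 s' Js' (d0P _ s'd).1.
    have [E1 E2] : act (f b) h = act (f b) h0 /\ act w h = act w h0.
      by apply: (jump s') => //; rewrite /P in Ps; nra.
    by move: Hhs; rewrite E1 E2.
  have [h Hh Hhs] := Hd1 s Js (d0P _ sd).1.
  have [E1 E2] : act (f b) h = act (f b) h0 /\ act w h = act w h0.
    by apply: (jump s) => //; rewrite /P in Ps; nra.
  by move: Hhs; rewrite E1 E2.
exists h0 => // e e_gt0.
(* A candidate within the smaller of [e] and [e0] must be the one of [h0], by [stay] and [jump];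
   hence the estimate with [e] holds for the fixed element [h0]. *)
have em0 : 0 < Num.min e e0 by rewrite lt_min e_gt0.
have [d2 d20 Hd2] := near_b _ em0.
exists (Num.min d2 d0); first by rewrite lt_min d20.
move=> s Js; rewrite lt_min => /andP[sd2 sd0].
have [h Hh Hhs] := Hd2 s Js sd2; have u0 := bJ s Js.
have em1 : Num.min e e0 <= e by rewrite ge_min lexx.
have em2 : Num.min e e0 <= e0 by rewrite ge_min lexx orbT.
have [E1 E2] : act (f b) h = act (f b) h0 /\ act w h = act w h0.
  apply: (jump s) => //; first by apply: le_trans Hhs _; rewrite ler_wpM2r.
  by have := stay s Js sd0; nra.
move: Hhs; rewrite E1 E2 opprD addrA => Hhs; apply: le_trans Hhs _.
by rewrite ler_wpM2r.
Qed.

Definition rball (t d : R) : set R := fun s => `|s - t| < d.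

Lemma rball_interval t d : is_interval (rball t d).
Proof. by move=> x y; rewrite /rball !ltr_norml => *; rewrite ltr_norml; lra. Qed.

Lemma rball_open t d : ropen (rball t d).
Proof.
move=> s; rewrite /rball => sd; exists (d - `|s - t|) => [|u us]; first by lra.
by have := ler_distD s u t; lra.
Qed.

Lemma rball_center t d : 0 < d -> rball t d t.
Proof. by rewrite /rball subrr normr0. Qed.

Lemma has_jet_cases (d : R) (J1 J2 J : set R) (F1 F2 F : R -> V) t v w : 0 < d ->
  (forall s, J s -> `|s - t| < d -> J1 s /\ F s = F1 s \/ J2 s /\ F s = F2 s) ->
  has_jet J1 F1 t v w -> has_jet J2 F2 t v w -> has_jet J F t v w.
Proof.
move=> d0 Hd H1 H2 e e0; have [d1 d10 Hd1] := H1 e e0; have [d2 d20 Hd2] := H2 e e0.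
exists (Num.min d (Num.min d1 d2)); first by rewrite !lt_min d0 d10.
move=> s Js; rewrite !lt_min => /and3P[sd sd1 sd2].
by have [[J1s ->]|[J2s ->]] := Hd s Js sd; [apply: Hd1 | apply: Hd2].
Qed.

Lemma has_jet_local (d : R) (J1 J : set R) (F1 F : R -> V) t v w : 0 < d ->
  (forall s, J s -> `|s - t| < d -> J1 s /\ F s = F1 s) ->
  has_jet J1 F1 t v w -> has_jet J F t v w.
Proof.
move=> d0 Hd H1; apply: (has_jet_cases d0 _ H1 H1) => s Js sd.
by left; apply: Hd.
Qed.

Lemma has_jet_sub J1 J F t v w : (forall s, J s -> J1 s) ->
  has_jet J1 F t v w -> has_jet J F t v w.
Proof. by move=> JJ; apply: (has_jet_local ltr01) => s /JJ. Qed.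

Lemma has_jet_act J F t v w h : h \in G -> has_jet J F t v w ->
  has_jet J (fun s => act (F s) h) t (act v h) (act w h).
Proof.
move=> Gh Fv e e0; have [d d0 Hd] := Fv e e0; exists d => // s Js sd.
by rewrite -actZ -!actB nrm_act //; apply: Hd.
Qed.

Lemma has_jet_diff_mod H J F t w : has_jet J F t (F t) w -> diff_mod H J F t w.
Proof.
move=> Fw e e0; have [d d0 Hd] := Fw e e0; exists d => // s Js sd.
by exists 1%g => //; rewrite act1; apply: Hd.
Qed.

Lemma lift_on_trans H J f F K : H \subset G -> lift_on H J f F -> lift_on H J F K ->
  lift_on H J f K.
Proof.
move=> /fintype.subsetP sHG fF FK s Js; have [g Hg Fs] := fF s Js.
have [h Hh ->] := FK s Js; exists (g * h)%g; first by rewrite groupM.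
by rewrite Fs actM ?sHG.
Qed.

Lemma lift_on_sym H J f F : H \subset G -> lift_on H J f F -> lift_on H J F f.
Proof.
move=> /fintype.subsetP sHG fF s Js; have [g Hg Fs] := fF s Js.
by exists g^-1%g; rewrite ?groupV // Fs actKV // sHG.
Qed.

(* Zorn's lemma on the lifts over open subintervals: a lift over [J] extends
   across a boundary point [b] of [J], because a local lift [L] at [b] can be
   moved by an element of [H] so as to match the one-sided first order
   expansion at [b]. *)
Lemma diff_lift_extend H I f J F : H \subset G ->
  is_interval I -> is_interval J -> ropen J -> (forall s, J s -> I s) ->
  diff_lift H J f F ->
  (forall t, I t -> exists2 d : R, 0 < d & (forall s, rball t d s -> I s) /\
     exists L, diff_lift H (rball t d) f L) ->
  (exists2 t, I t & ~ J t) ->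
  exists J' F', [/\ (forall s, J' s -> I s), is_interval J', ropen J',
    diff_lift H J' f F' & [/\ (forall s, J s -> J' s), (forall s, J s -> F' s = F s)
    & exists2 t, J' t & ~ J t]].
Proof.
move=> sHG Iint Jint Jo JI [Ff Fd] loc [t1 It1 nJt1].
have sHG' := fintype.subsetP sHG.
have [[s1 Js1]|none] := pselect (exists s, J s); last first.
  have [d d0 [dI [L fL]]] := loc t1 It1.
  exists (rball t1 d), L; split=> //; first exact: rball_interval.
    exact: rball_open.
  split; [by move=> s Js; case: none; exists s | by move=> s Js; case: none; exists s|].
  by exists t1 => //; apply: rball_center.
(* Such a boundary point exists, as otherwise membership in [J] would be locally constant on [I]. *)
have [b [Ib nJb bJ]] : exists b, [/\ I b, ~ J b &
    forall d : R, 0 < d -> exists2 s, J s & `|s - b| < d].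
  apply: contrapT => nob; apply: nJt1.
  apply: (@locally_constant _ I J Iint _ s1 t1) => //; last exact: JI.
  move=> s Is; have [Js|nJs] := pselect (J s).
    have [d d0 Hd] := Jo s Js; exists d => // s' _ ss'.
    by split=> // _; apply: Hd.
  have [[d d0 Hd]|no] := pselect (exists2 d : R, 0 < d & forall s', J s' -> ~ `|s' - s| < d).
    by exists d => // s' _ ss'; split=> // Js'; case: (Hd s').
  case: nob; exists s; split=> // d d0; apply: contrapT => no'; apply: no.
  by exists d => // s' Js' ss'; apply: no'; exists s'.
have [d d0 [dI [L [fL Ld]]]] := loc b Ib.
have nb s : J s -> s != b by move=> Js; apply/eqP => sb; apply: nJb; rewrite -sb.
(* The bound [|s1 - b|] leaves [s1] outside the ball, so [J] covers the whole half of the ball on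
   its own side of [b]. *)
pose e := Num.min d `|s1 - b|.
have e0 : 0 < e by rewrite lt_min d0 normr_gt0 subr_eq0 nb.
have ed s : rball b e s -> rball b d s by rewrite /rball lt_min => /andP[].
have es1 s : rball b e s -> `|s - b| < `|s1 - b| by rewrite /rball lt_min => /andP[].
have [wL HwL] := Ld b (rball_center b d0).
pose J1 : set R := fun s => J s /\ rball b e s.
have J1int : is_interval J1.
  move=> x y [Jx xe] [Jy ye] z xzy; split; first exact: (Jint x y).
  exact: (@rball_interval b e x y).
(* [L] replaces [f] as reference curve: it has a true jet at [b], and [F] is a lift of it. *)
have [h Hh Hjet] : exists2 h, h \in H & has_jet J1 F b (act (L b) h) (act wL h).
  apply: (@one_sided_jet H J1 (rball b d) L F b wL) => //; first by move=> s [_ /ed].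
  - by move=> [].
  - exact: has_jet_diff_mod.
  - split; last first.
      by move=> s [Js _]; have [w Hw] := Fd s Js; exists w; apply: has_jet_sub Hw => u [].
    apply: (lift_on_trans sHG (f := L) (F := f)).
      by apply: lift_on_sym => // s [_ /ed]; apply: fL.
    by move=> s [Js _]; apply: Ff.
have Gh := sHG' h Hh.
pose F' s := if pselect (J s) then F s else act (L s) h.
have F'J s : J s -> F' s = F s by rewrite /F'; case: pselect.
have F'L s : ~ J s -> F' s = act (L s) h by rewrite /F'; case: pselect.
exists (fun s => J s \/ rball b e s), F'; split.
- by move=> s [/JI//|/ed/dI].
- have [s2 Js2 s2e] := bJ e e0.
  move=> x y [Jx|xe] [Jy|ye] z xzy.
  + by left; apply: (Jint x y).
  + have [zs|sz] := leP z s2.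
      by left; apply: (Jint x s2) => //; case/andP: xzy => -> _.
    by right; apply: (@rball_interval b e s2 y) => //; case/andP: xzy => _ ->; rewrite ltW.
  + have [zs|sz] := leP s2 z.
      by left; apply: (Jint s2 y) => //; case/andP: xzy => _ ->; rewrite zs.
    by right; apply: (@rball_interval b e x s2) => //; case/andP: xzy => -> _; rewrite ltW.
  + by right; apply: (@rball_interval b e x y).
- move=> s [Js|se].
    by have [d1 d10 Hd1] := Jo s Js; exists d1 => // u us; left; apply: Hd1.
  by have [d1 d10 Hd1] := rball_open se; exists d1 => // u us; right; apply: Hd1.
- split=> [s|t].
    have [Js _|nJs] := pselect (J s); first by rewrite F'J //; apply: Ff.
    move=> [//|/ed sd]; rewrite F'L //; have [g Hg ->] := fL s sd.
    by exists (g * h)%g; rewrite ?groupM // actM // sHG'.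
  have [Jt _|nJt] := pselect (J t).
    have [w Hw] := Fd t Jt; exists w; rewrite F'J //.
    have [d1 d10 Hd1] := Jo t Jt.
    by apply: (has_jet_local d10 _ Hw) => s _ st; have Js := Hd1 s st; rewrite F'J.
  move=> [//|te].
  have [tb|tb] := eqVneq t b.
    exists (act wL h); rewrite tb F'L //.
    apply: (has_jet_cases e0 _ Hjet (has_jet_act Gh HwL)) => s _ sb.
    have [Js|nJs] := pselect (J s); first by left; rewrite F'J.
    by right; rewrite F'L //; split=> //; apply: ed.
  have [w Hw] := Ld t (ed _ te); exists (act w h); rewrite F'L //.
  have tb0 : 0 < `|t - b| by rewrite normr_gt0 subr_eq0.
  have r0 : 0 < Num.min `|t - b| (e - `|t - b|).
    by rewrite lt_min tb0 subr_gt0.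
  apply: (has_jet_local r0 _ (has_jet_act Gh Hw)) => s _; rewrite lt_min => /andP[st1 st2].
  have se : rball b e s by rewrite /rball; have := ler_distD t s b; lra.
  rewrite F'L //; first by split=> //; apply: ed.
  (* Here [s] is nearer to [t] than [b] is, hence on the same side of [b] as [t]. As [J] omits [b],
     it lies on that side; it contains [s1] farther from [b] than [t] and [s2] nearer to [b], so it
     would contain [t]. *)
  move=> Js; apply: nJt; have [s2 Js2 s2t] := bJ _ tb0; have t_s1 := es1 _ te.
  have side u u' : J u -> J u' -> u < b -> u' < b.
    move=> Ju Ju' ub; rewrite ltNge; apply/negP => bu'; apply: nJb.
    by apply: (Jint u u') => //; rewrite (ltW ub).
  move: (nb _ Js); rewrite neq_lt => /orP[sb|bs].
    have tb' : t < b.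
      rewrite ltNge; apply/negP => bt; move: st1.
      by rewrite (ger0_norm (x := t - b)) ?subr_ge0 // ltr_norml; lra.
    have normE u : u < b -> `|u - b| = b - u.
      by move=> ub; rewrite ltr0_norm ?opprB // subr_lt0.
    apply: (Jint s1 s2) => //; move: s2t t_s1.
    by rewrite !normE; [lra| apply: (side s) | by [] | apply: (side s)].
  have right u : J u -> b < u.
    move=> Ju; rewrite lt_neqAle eq_sym nb //= leNgt; apply/negP.
    by move=> /(side _ _ Ju Js) sb; lra.
  have tb' : b < t.
    rewrite ltNge; apply/negP => bt; move: st1.
    by rewrite (ler0_norm (x := t - b)) ?subr_le0 // ltr_norml; lra.
  apply: (Jint s2 s1) => //; move: s2t t_s1.
  have normE u : b < u -> `|u - b| = u - b.
    by move=> bu; rewrite gtr0_norm // subr_gt0.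
  by rewrite !normE; [lra| apply: right | by [] | apply: right].
- split; first by move=> s Js; left.
    by move=> s Js; apply: F'J.
  by exists b => //; right; apply: rball_center.
Qed.

(** Local lifts need not agree on overlaps, so they cannot simply be united. Along a chain they do
    agree, and openness of the domains passes differentiability to the union; a maximal lift is then
    global by [diff_lift_extend]. *)
Lemma diff_lift_global H I f : H \subset G -> is_interval I ->
  (forall t, I t -> exists2 d : R, 0 < d & (forall s, rball t d s -> I s) /\
     exists L, diff_lift H (rball t d) f L) ->
  exists F, diff_lift H I f F.
Proof.
move=> sHG Iint loc.
pose ok (p : set R * (R -> V)) := [/\ (forall s, p.1 s -> I s), is_interval p.1,
  ropen p.1 & diff_lift H p.1 f p.2].
pose T := {p | ok p}.
pose le (p q : T) := `[< (forall s, (sval p).1 s -> (sval q).1 s) /\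
  (forall s, (sval p).1 s -> (sval q).2 s = (sval p).2 s) >].
have ok0 : ok (set0, f) by split=> //; split.
have le_refl p : le p p by apply/asboolP.
have le_trans p q u : le p q -> le q u -> le p u.
  move=> /asboolP[pq1 pq2] /asboolP[qr1 qr2]; apply/asboolP; split=> s ps.
    by apply/qr1/pq1.
  by rewrite qr2 ?pq2 //; apply: pq1.
have [|p0 p0max] := ZL_preorder (exist _ _ ok0) le_refl le_trans.
  move=> A Atot.
  pose J : set R := fun s => exists p, A p /\ (sval p).1 s.
  pose F s := if pselect (J s) is left Js then (sval (projT1 (cid Js))).2 s else 0.
  have F_eq p s : A p -> (sval p).1 s -> F s = (sval p).2 s.
    move=> Ap ps; rewrite /F; case: pselect => [Js|[]]; last by exists p.
    case: cid => q [Aq qs] /=.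
    by have [/asboolP[_ pq]|/asboolP[_ pq]] := Atot _ _ Ap Aq; rewrite pq.
  have okJF : ok (J, F).
    split=> /=.
    - by move=> s [p [Ap ps]]; have [pI _ _ _] := svalP p; apply: pI.
    - move=> x y [p [Ap px]] [q [Aq qy]] z xzy.
      have [/asboolP[pq _]|/asboolP[qp _]] := Atot _ _ Ap Aq.
        by exists q; split=> //; have [_ qi _ _] := svalP q; apply: (qi x y) => //; apply: pq.
      by exists p; split=> //; have [_ pi _ _] := svalP p; apply: (pi x y) => //; apply: qp.
    - move=> s [p [Ap ps]]; have [_ _ po _] := svalP p; have [d d0 Hd] := po s ps.
      by exists d => // u us; exists p; split=> //; apply: Hd.
    - split=> s [p [Ap ps]]; have [_ _ po [pl pd]] := svalP p.
        by rewrite (F_eq p) //; apply: pl.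
      have [w Hw] := pd s ps; exists w; rewrite (F_eq p) //.
      have [d d0 Hd] := po s ps; apply: (has_jet_local d0 _ Hw) => u _ us.
      by have pu := Hd u us; rewrite (F_eq p).
  exists (exist _ _ okJF) => p Ap; apply/asboolP; split=> s ps /=.
    by exists p.
  by rewrite (F_eq p).
have [p0I p0int p0o p0l] := svalP p0.
have [[t It nt]|all] := pselect (exists2 t, I t & ~ (sval p0).1 t).
  have [|J' [F' [J'I J'int J'o J'l [JJ' FF' [u J'u nu]]]]] :=
    diff_lift_extend sHG Iint p0int p0o p0I p0l loc; first by exists t.
  have ok' : ok (J', F') by [].
  have /p0max/asboolP[/(_ u J'u)//] : le p0 (exist _ _ ok') by apply/asboolP.
exists (sval p0).2; have I_p0 s : I s -> (sval p0).1 s.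
  by move=> Is; apply: contrapT => ns; apply: all; exists s.
have [pl pd] := p0l; split=> s Is; first by apply: pl; apply: I_p0.
have [w Hw] := pd s (I_p0 s Is); exists w; exact: has_jet_sub Hw.
Qed.

(** * Induction on the order of the group *)

Let nrm_small x : (forall e : R, 0 < e -> nrm x <= 2 * e) -> x = 0.
Proof.
move=> xe; apply: contrapT => /nrm_gt0 x0.
by have := xe (nrm x / 4); rewrite divr_gt0 // => /(_ isT); lra.
Qed.

(** One [g] serves both estimates: with relative error at most [1] the values differ by at most
    [(1 + nrm w) |s - t|]. *)
Lemma diff_mod_near (H : {set gT}) J f t w : diff_mod H J f t w ->
  forall e : R, 0 < e -> exists2 d : R, 0 < d & forall s, J s -> `|s - t| < d ->
  exists g, [/\ g \in H, nrm (act (f s) g - f t) <= e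
    & nrm (act (f s) g - f t - (s - t) *: w) <= e * `|s - t|].
Proof.
move=> fw e e0.
have e10 : 0 < Num.min 1 e by rewrite lt_min ltr01.
have [d d0 Hd] := fw _ e10.
have w0 := nrm_ge0 w; have C0 : 0 < 1 + nrm w by lra.
exists (Num.min d (e / (1 + nrm w))); first by rewrite lt_min d0 divr_gt0.
move=> s Js; rewrite lt_min => /andP[sd]; rewrite ltr_pdivlMr // mulrDr mulr1 => se.
have [g Hg Hge] := Hd s Js sd; exists g.
have le1 : Num.min 1 e * `|s - t| <= `|s - t|.
  by rewrite -[leRHS]mul1r ler_wpM2r // ge_min lexx.
have le2 : Num.min 1 e * `|s - t| <= e * `|s - t|.
  by rewrite ler_wpM2r // ge_min lexx orbT.
split=> //; last by lra.
have := nrmD (act (f s) g - f t - (s - t) *: w) ((s - t) *: w).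
rewrite subrK nrmZ; lra.
Qed.

Lemma diff_mod_sub (H : {set gT}) J1 J f t w : (forall s, J s -> J1 s) ->
  diff_mod H J1 f t w -> diff_mod H J f t w.
Proof.
move=> JJ fw e e0; have [d d0 Hd] := fw e e0; exists d => // s /JJ; exact: Hd.
Qed.

Lemma diff_lift_sub (H : {set gT}) J1 J f F : (forall s, J s -> J1 s) ->
  diff_lift H J1 f F -> diff_lift H J f F.
Proof.
move=> JJ [lF dF]; split=> s /JJ J1s; first exact: lF.
by have [w Hw] := dF s J1s; exists w; apply: has_jet_sub Hw.
Qed.

(** The element taking [f t] to [F t] also moves the derivative, which makes the condition
    independent of the chosen lift. *)
Lemma diff_mod_lift H J f F t w : H \subset G -> diff_mod H J f t w ->
  lift_on H J f F -> J t -> exists w', diff_mod H J F t w'.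
Proof.
move=> sHG fw fF Jt; have [k Hk Ft] := fF t Jt; exists (act w k) => e e0.
have [d d0 Hd] := lift_diff_mod sHG (fun s Js => Js) fw fF e0.
exists d => // s Js sd; have [h Hh Hhs] := Hd s Js sd.
have sHG' := fintype.subsetP sHG; have Gh := sHG' h Hh; have Gk := sHG' k Hk.
exists (h^-1 * k)%g; first by rewrite groupM ?groupV.
have Ghk : (h^-1 * k)%g \in G by rewrite groupM ?groupV.
move: Hhs; rewrite -(nrm_act _ Ghk) opprD addrA !actB actZ.
by rewrite !(actM _ Gh) // mulKVg Ft.
Qed.

Definition lifting_property H := forall I f, is_interval I -> ropen I ->
  (forall t, I t -> exists w, diff_mod H I f t w) -> exists F, diff_lift H I f F.

(** The stabilizer [K] of [f t] in [H] is proper. After replacing [f] near [t] by translates close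
    to [f t], only elements of [K] can bring nearby values together, so the condition holds modulo
    [K] and induction applies. *)
Lemma local_lift_nonfixed H I f t : H \subset G ->
  (forall K : {group gT}, K \subset G -> (#|K| < #|H|)%N -> lifting_property K) ->
  ropen I -> (forall t, I t -> exists w, diff_mod H I f t w) -> I t ->
  (exists2 g, g \in H & act (f t) g <> f t) ->
  exists2 d : R, 0 < d & (forall s, rball t d s -> I s) /\
    exists L, diff_lift H (rball t d) f L.
Proof.
move=> sHG IH Io fI It [g0 Hg0 g0t]; set v := f t.
have sHG' := fintype.subsetP sHG.
pose K0 := [set g in H | `[< act v g = v >]].
have K0g : group_set K0.
  apply/group_setP; split; first by rewrite inE group1 /=; apply/asboolP.
  move=> x y; rewrite !inE => /andP[Hx /asboolP vx] /andP[Hy /asboolP vy].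
  by rewrite groupM //=; apply/asboolP; rewrite -actM ?sHG' // vx.
pose K := Group K0g.
have sKH : K \subset H by apply/fintype.subsetP => g; rewrite inE => /andP[].
have KH : (#|K| < #|H|)%N.
  apply: proper_card; apply/properP; split=> //; exists g0 => //.
  by rewrite inE Hg0 /=; apply/asboolP.
(* Elements outside [K] displace [v] by at least [4 r]. The three errors of size [r] below (from
   [f' s] to [v], from [f' s1] to [v], from the translate of [f' s] to [f' s1]) only add up to
   [3 r]. *)
have [r r0 Hr] : exists2 r : R, 0 < r & forall g, g \in H -> act v g <> v ->
    4 * r <= nrm (act v g - v).
  apply: (@finite_radius _ _ (fun g (r : R) => g \in H -> act v g <> v ->
    4 * r <= nrm (act v g - v))) => [g d d' dd' Hd Hg vg | g].
    by have := Hd Hg vg; lra.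
  have [vg|vg] := pselect (act v g = v); first by exists 1.
  exists (nrm (act v g - v) / 4); last by move=> _ _; lra.
  by rewrite divr_gt0 // nrm_gt0 // => /eqP; rewrite subr_eq0 => /eqP.
have [w Hw] := fI t It; have [d1 d10 Hd1] := diff_mod_near Hw r0.
have [d2 d20 Hd2] := Io t It.
pose d := Num.min d1 d2; have d0 : 0 < d by rewrite lt_min d10.
have dI s : rball t d s -> I s by rewrite /rball lt_min => /andP[_ /Hd2].
have [gs Hgs] : {gs : R -> gT & forall s, rball t d s ->
    gs s \in H /\ nrm (act (f s) (gs s) - v) <= r}.
  apply: (@choice _ _ (fun s g => rball t d s ->
    g \in H /\ nrm (act (f s) g - v) <= r)) => s; have [sd|nsd] := pselect (rball t d s); last by exists 1%g.
  have [|g [Hg gr _]] := Hd1 s (dI s sd); last by exists g.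
  by move: sd; rewrite /rball lt_min => /andP[].
pose f' s := act (f s) (gs s).
have ff' : lift_on H (rball t d) f f' by move=> s /Hgs[Hg _]; exists (gs s).
exists d => //; split=> //.
have [|F [lF dF]] := IH K (fintype.subset_trans sKH sHG) KH (rball t d) f'
    (@rball_interval t d) (@rball_open t d).
  move=> s1 s1d; have [w0 Hw0] := fI s1 (dI s1 s1d).
  have [w1 Hw1] := diff_mod_lift sHG (diff_mod_sub dI Hw0) ff' s1d.
  exists w1 => e e0; have er0 : 0 < Num.min e r by rewrite lt_min e0.
  have [d3 d30 Hd3] := diff_mod_near Hw1 er0; exists d3 => // s sd ss1.
  have [g [Hg g1 g2]] := Hd3 s sd ss1; exists g; last first.
    by apply: le_trans g2 _; rewrite ler_wpM2r // ge_min lexx.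
  rewrite inE Hg /=; apply/asboolP; apply: contrapT => /(Hr g Hg).
  have g1r : nrm (act (f' s) g - f' s1) <= r by apply: le_trans g1 _; rewrite ge_min lexx orbT.
  have := nrm_tri (act v g) (act (f' s) g) v; rewrite -actB nrm_act ?sHG' //.
  have := nrm_tri (act (f' s) g) (f' s1) v; rewrite (nrmBC v (f' s)).
  by have := (Hgs s sd).2; have := (Hgs s1 s1d).2; rewrite -/(f' s) -/(f' s1); lra.
exists F; split=> //; apply: (lift_on_trans sHG ff') => s /lF[g Kg ->].
by exists g => //; apply: (fintype.subsetP sKH).
Qed.

(** The halves are not matched with each other but each with [(f t, w)]: undoing the element given
    by [one_sided_jet] yields this jet on both sides, and the value [f t] fills the gap. *)
Lemma diff_lift_two_sides H I f t : H \subset G -> ropen I ->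
  (forall t, I t -> exists w, diff_mod H I f t w) -> I t ->
  (exists2 d : R, 0 < d & forall s, rball t d s -> s != t -> I s ->
    exists2 d' : R, 0 < d' & exists L, diff_lift H (rball s d') f L) ->
  exists2 d : R, 0 < d & (forall s, rball t d s -> I s) /\
    exists L, diff_lift H (rball t d) f L.
Proof.
move=> sHG Io fI It [d1 d10 Hd1]; have sHG' := fintype.subsetP sHG.
have [d2 d20 Hd2] := Io t It.
pose d := Num.min d1 d2; have d0 : 0 < d by rewrite lt_min d10.
have dI s : rball t d s -> I s by rewrite /rball lt_min => /andP[_ /Hd2].
have [w Hw] := fI t It.
have half J : is_interval J -> ropen J -> (forall s, J s -> rball t d s) -> ~ J t ->
    exists2 F, diff_lift H J f F & has_jet J F t (f t) w.
  move=> Jint Jo Jd nJt; have [|F [lF dF]] := diff_lift_global sHG Jint (f := f).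
    move=> s Js; have [d3 d30 Hd3] := Jo s Js.
    have sd := Jd s Js; have st : s != t by apply/eqP => st; apply: nJt; rewrite -st.
    have [|d4 d40 [L HL]] := Hd1 s _ st (dI s sd).
      by move: sd; rewrite /rball lt_min => /andP[].
    exists (Num.min d3 d4); first by rewrite lt_min d30.
    split=> [u|]; first by rewrite /rball lt_min => /andP[/Hd3].
    by exists L; apply: diff_lift_sub HL => u; rewrite /rball lt_min => /andP[].
  have [h Hh hjet] := one_sided_jet sHG Jint (fun s Js => dI s (Jd s Js)) nJt Hw
    (conj lF dF).
  have Gh := sHG' h Hh; have Gh' : h^-1%g \in G by rewrite groupV.
  exists (fun s => act (F s) h^-1%g); last first.
    by have := has_jet_act Gh' hjet; rewrite !actKV.
  split=> s Js.
    have [g Hg ->] := lF s Js; exists (g * h^-1)%g; first by rewrite groupM ?groupV.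
    by rewrite actM // sHG'.
  have [w' Hw'] := dF s Js; exists (act w' h^-1%g); exact: has_jet_act.
pose Jl s := s < t /\ rball t d s; pose Jr s := t < s /\ rball t d s.
have [|||//|Fl [lFl dFl] jl] := half Jl.
- by move=> x y [xt xd] [yt yd] z xzy; split; [lra | apply: (@rball_interval t d x y)].
- move=> s [st /rball_open[d3 d30 Hd3]]; exists (Num.min d3 (t - s)).
    by rewrite lt_min d30 subr_gt0.
  move=> u; rewrite lt_min => /andP[/Hd3 ud]; rewrite ltr_norml => us.
  by split=> //; lra.
- by move=> s [].
- by move=> []; rewrite ltxx.
have [|||//|Fr [lFr dFr] jr] := half Jr.
- by move=> x y [xt xd] [yt yd] z xzy; split; [lra | apply: (@rball_interval t d x y)].
- move=> s [st /rball_open[d3 d30 Hd3]]; exists (Num.min d3 (s - t)).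
    by rewrite lt_min d30 subr_gt0.
  move=> u; rewrite lt_min => /andP[/Hd3 ud]; rewrite ltr_norml => us.
  by split=> //; lra.
- by move=> s [].
- by move=> []; rewrite ltxx.
pose F s := if s < t then Fl s else if t < s then Fr s else f t.
have F_l s : s < t -> F s = Fl s by rewrite /F => ->.
have F_r s : t < s -> F s = Fr s by rewrite /F; case: ltgtP.
exists d => //; split=> //; exists F; split=> s sd.
  have [st|ts|->] := ltgtP s t.
  - by rewrite F_l //; apply: lFl.
  - by rewrite F_r //; apply: lFr.
  - by exists 1%g => //; rewrite act1 /F ltxx.
have [st|ts|->] := ltgtP s t.
- have [w' Hw'] := dFl s (conj st sd); exists w'; rewrite F_l //.
  apply: (@has_jet_local (t - s) _ _ _ _ _ _ _ _ _ Hw'); first by lra.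
  by move=> u ud; rewrite ltr_norml => us; rewrite F_l; [split=> //; split=> //|]; lra.
- have [w' Hw'] := dFr s (conj ts sd); exists w'; rewrite F_r //.
  apply: (@has_jet_local (s - t) _ _ _ _ _ _ _ _ _ Hw'); first by lra.
  by move=> u ud; rewrite ltr_norml => us; rewrite F_r; [split=> //; split=> //|]; lra.
- have Ft : F t = f t by rewrite /F ltxx.
  exists w; rewrite Ft.
  have jt : has_jet (fun s => s = t) F t (f t) w.
    move=> e e0; exists 1 => // u -> _.
    by rewrite Ft !subrr scale0r normr0 mulr0 subrr nrm0.
  have jrt : has_jet (fun s => t <= s /\ rball t d s) F t (f t) w.
    apply: (has_jet_cases ltr01 _ jt jr) => u [tu ud] _.
    move: tu; rewrite le_eqVlt => /predU1P[->|tu]; first by left.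
    by right; rewrite F_r.
  apply: (has_jet_cases ltr01 _ jl jrt) => u ud _.
  by have [ut|tu] := ltP u t; [left; rewrite F_l | right].
Qed.

(* At an accumulation point of parameters with [H]-fixed value, both the value
   and the derivative are [H]-fixed, so that every lift is differentiable. *)
Lemma has_jet_accumulation H I f F t w : H \subset G -> diff_mod H I f t w ->
  lift_on H I f F -> I t ->
  (forall d : R, 0 < d -> exists s, [/\ I s, (forall g, g \in H -> act (f s) g = f s),
     s != t & `|s - t| < d]) ->
  has_jet I F t (F t) w.
Proof.
move=> sHG fw fF It acc; have sHG' := fintype.subsetP sHG.
have fix_v g : g \in H -> act (f t) g = f t.
  move=> Hg; have Gg := sHG' g Hg; apply/eqP; rewrite -subr_eq0; apply/eqP.
  apply: nrm_small => e e0; have [d d0 Hd] := diff_mod_near fw e0.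
  have [s [Is fs _ sd]] := acc d d0; have [k [Hk]] := Hd s Is sd.
  rewrite (fs k Hk) => fst _.
  have := nrm_tri (act (f t) g) (act (f s) g) (f t).
  by rewrite -actB nrm_act // (nrmBC (f t) (f s)) fs //; lra.
have fix_w g : g \in H -> act w g = w.
  move=> Hg; have Gg := sHG' g Hg; apply/eqP; rewrite -subr_eq0; apply/eqP.
  apply: nrm_small => e e0; have [d d0 Hd] := fw e e0.
  have [s [Is fs st sd]] := acc d d0; have [k Hk] := Hd s Is sd.
  rewrite (fs k Hk); set x := _ - _ - _ => xe.
  have st0 : 0 < `|s - t| by rewrite normr_gt0 subr_eq0.
  (* Since [f s] and [f t] are fixed by [g], the remainder fails to be invariant exactly by
     [(s - t)] times the defect of [w]. *)
  have xg : x - act x g = (s - t) *: (act w g - w).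
    rewrite /x !actB actZ fs // fix_v // scalerBr.
    by set a := f s - f t; rewrite opprB addrC addrA subrK.
  rewrite -(ler_pM2l st0) -nrmZ -xg.
  by have := nrmD x (- act x g); rewrite nrmN nrm_act //; lra.
have Ft : F t = f t by have [g Hg ->] := fF t It; rewrite fix_v.
move=> e e0; have [d d0 Hd] := lift_diff_mod sHG (fun s Is => Is) fw fF e0.
exists d => // s Is sd; have [h Hh] := Hd s Is sd.
by rewrite fix_v // fix_w // Ft opprD addrA.
Qed.

Theorem diff_lift_exists H : H \subset G -> lifting_property H.
Proof.
have [n leHn] := ubnP #|H|; elim: n => // n IHn in H leHn * => sHG I f Iint Io fI.
pose fixed s := forall g, g \in H -> act (f s) g = f s.
pose acc t := forall d : R, 0 < d -> exists s, [/\ I s, fixed s, s != t & `|s - t| < d].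
pose U t := I t /\ ~ acc t.
have IH (K : {group gT}) : K \subset G -> (#|K| < #|H|)%N -> lifting_property K.
  by move=> sKG KH; apply: IHn => //; apply: leq_trans KH _.
have isolated t : U t -> exists2 d : R, 0 < d & forall s, rball t d s -> I s ->
    s != t -> ~ fixed s.
  move=> [It nacc]; apply: contrapT => no; apply: nacc => d d0; apply: contrapT => none.
  apply: no; exists d => // s sd Is st fs; apply: none; by exists s.
have Uo : ropen U.
  move=> t Ut; have [d d0 Hd] := isolated t Ut; have [d1 d10 Hd1] := Io t Ut.1.
  exists (Num.min d d1); first by rewrite lt_min d0.
  move=> s; rewrite lt_min => /andP[sd /Hd1 Is]; split=> // accs.
  have [st|st] := eqVneq s t; first by apply: Ut.2; rewrite -st.
  have [d2 d20 Hd2] := rball_open sd.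
  have e0 : 0 < Num.min d2 `|s - t| by rewrite lt_min d20 normr_gt0 subr_eq0.
  have [u [Iu fu us]] := accs _ e0; rewrite lt_min => /andP[ud2 ust].
  apply: (Hd u) fu => //; first exact: Hd2.
  by apply/eqP => ut; move: ust; rewrite ut distrC ltxx.
have loc t : U t -> exists2 d : R, 0 < d & (forall s, rball t d s -> U s) /\
    exists L, diff_lift H (rball t d) f L.
  move=> Ut; have [d1 d10 Hd1] := Uo t Ut.
  have [|d d0 [_ [L HL]]] := diff_lift_two_sides sHG Io fI Ut.1.
    have [d d0 Hd] := isolated t Ut; exists d => // s sd st Is.
    have [|d' d'0 [_ HL]] := local_lift_nonfixed sHG IH Io fI Is; last by exists d'.
    apply: contrapT => nog; apply: (Hd s) => // g Hg; apply: contrapT => gs.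
    by apply: nog; exists g.
  exists (Num.min d d1); first by rewrite lt_min d0.
  split=> [s|]; first by rewrite /rball lt_min => /andP[_ /Hd1].
  by exists L; apply: diff_lift_sub HL => s; rewrite /rball lt_min => /andP[].
(* [C t] is the component of [t] in [U], described by segments; it is empty when [t] lies outside
   [U]. *)
pose C t : set R := fun s => forall z, (s <= z <= t) || (t <= z <= s) -> U z.
have C_lift t : exists F, diff_lift H (C t) f F.
  apply: diff_lift_global => //.
    move=> x y Cx Cy z /andP[xz zy] u /orP[/andP[zu ut]|/andP[tu uz]].
      by apply: Cx; rewrite ut (le_trans xz zu).
    by apply: Cy; rewrite tu (le_trans uz zy) orbT.
  move=> s Cs; have Us : U s by apply: Cs; rewrite lexx andbT le_total.
  have [d d0 [Ud HL]] := loc s Us; exists d => //; split=> // u ud z zu.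
  have [zs|zs] := pselect ((s <= z <= t) || (t <= z <= s)); first exact: Cs.
  apply: Ud; move: ud; rewrite /rball !ltr_norml.
  move/negP: zs; case/orP: zu => /andP[] *; lra.
have CE t s : C t s -> C t = C s.
  move=> Cs; apply/seteqP; split=> u Cu z.
    move=> zu; have [?|/negP ?] := boolP ((s <= z <= t) || (t <= z <= s)); first exact: Cs.
    apply: Cu; lra.
  move=> zu; have [?|/negP ?] := boolP ((s <= z <= t) || (t <= z <= s)); first exact: Cs.
  apply: Cu; lra.
(* The lift is chosen as a function of the component as a set, so that by [CE] all parameters of one
   component use the same lift. *)
pose Phi (A : set R) : R -> V :=
  if pselect (exists F, diff_lift H A f F) is left ex then projT1 (cid ex) else f.
have PhiP t : diff_lift H (C t) f (Phi (C t)).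
  by rewrite /Phi; case: pselect => [ex|[]//]; case: cid.
pose F t := if pselect (U t) then Phi (C t) t else f t.
have F_U t : U t -> F t = Phi (C t) t by rewrite /F; case: pselect.
have C_refl t : U t -> C t t by move=> Ut z; rewrite orbb -eq_le => /eqP <-.
have F_lift : lift_on H I f F.
  move=> t It; rewrite /F; case: pselect => [Ut|nUt]; last by exists 1%g.
  by have [lP _] := PhiP t; apply: lP; apply: C_refl.
(* Infinitely many components with unrelated lifts may accumulate at a point outside [U]; this is
   harmless, as every lift has the expansion there. *)
exists F; split=> // t It; have [Ut|nUt] := pselect (U t); last first.
  have acct : acc t by apply: contrapT => nacc; apply: nUt.
  by have [w Hw] := fI t It; exists w; apply: has_jet_accumulation Hw F_lift It acct.
have [_ dP] := PhiP t; have [w Hw] := dP t (C_refl t Ut); exists w.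
rewrite F_U //; have [d d0 Hd] := Uo t Ut; apply: (has_jet_local d0 _ Hw) => s _ st.
have Cts : C t s.
  move=> z zst; apply: Hd; move: st; rewrite !ltr_norml.
  by case/orP: zst => /andP[] *; lra.
split=> //; rewrite F_U; last exact: Hd.
by rewrite -(CE t s Cts).
Qed.

End DifferentiableLift.

(** * Polynomial invariants of finite groups *)

Local Notation "''Y_' i" := (mpoly.mpolyX _ (mpoly.mnm1 i))
  (at level 8, i at level 2).
Local Notation homog d := (mpoly.ishomog1 d (@mpoly.mdeg _)).

Section PolynomialAction.

Variables (R : realType) (N : nat).

Implicit Types (A B : 'M[R[i]]_N) (p q : cpoly R N) (x : 'rV[R[i]]_N).

Definition ev (k : nat) (p : cpoly R k) (x : 'rV[R[i]]_k) : R[i] :=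
  mpoly.meval (fun i => x 0 i) p.

Lemma evB k (p q : cpoly R k) (x : 'rV[R[i]]_k) : ev (p - q) x = ev p x - ev q x.
Proof. exact: mpoly.mevalB. Qed.

Lemma evC k c (x : 'rV[R[i]]_k) : ev (mpoly.mpolyC k c) x = c.
Proof. exact: mpoly.mevalC. Qed.

Lemma ev_prod k (I : Type) (r : seq I) (P : pred I) (F : I -> cpoly R k) (x : 'rV[R[i]]_k) :
  ev (\prod_(i <- r | P i) F i) x = \prod_(i <- r | P i) ev (F i) x.
Proof. exact: rmorph_prod. Qed.

Lemma polymapE k (s : 'I_k -> cpoly R N) x j : polymap s x 0 j = ev (s j) x.
Proof. by rewrite mxE. Qed.

Lemma ev_subst k (s : 'I_k -> cpoly R N) (q : cpoly R k) x :
  ev (subst s q) x = ev q (polymap s x).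
Proof.
rewrite /ev /subst mpoly.comp_mpoly_meval; apply: mpoly.meval_eq => j.
by rewrite tnth_mktuple polymapE.
Qed.

Lemma poly_actX A j : poly_act A 'Y_j = \sum_(i < N) A i j *: 'Y_i.
Proof. by rewrite /poly_act mpoly.comp_mpolyXU -tnth_nth tnth_mktuple. Qed.

Lemma ev_poly_act A p x : ev (poly_act A p) x = ev p (x *m A).
Proof.
rewrite /ev /poly_act mpoly.comp_mpoly_meval; apply: mpoly.meval_eq => j.
rewrite tnth_mktuple mxE raddf_sum /=; apply: eq_bigr => i _.
by rewrite mpoly.mevalZ mpoly.mevalXU mulrC.
Qed.

Lemma poly_actD A p q : poly_act A (p + q) = poly_act A p + poly_act A q.
Proof. exact: raddfD. Qed.

Lemma poly_actZ A c p : poly_act A (c *: p) = c *: poly_act A p.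
Proof. exact: linearZ. Qed.

Lemma poly_actM A p q : poly_act A (p * q) = poly_act A p * poly_act A q.
Proof. exact: rmorphM. Qed.

Lemma poly_act_sum A (I : Type) (r : seq I) (P : pred I) (F : I -> cpoly R N) :
  poly_act A (\sum_(i <- r | P i) F i) = \sum_(i <- r | P i) poly_act A (F i).
Proof. exact: raddf_sum. Qed.

Lemma cpoly_morph_ext (f g : cpoly R N -> cpoly R N) :
  (forall p q, f (p + q) = f p + f q) -> (forall c p, f (c *: p) = c *: f p) ->
  (forall p q, f (p * q) = f p * f q) -> f 1 = 1 ->
  (forall p q, g (p + q) = g p + g q) -> (forall c p, g (c *: p) = c *: g p) ->
  (forall p q, g (p * q) = g p * g q) -> g 1 = 1 ->
  (forall i, f 'Y_i = g 'Y_i) -> f =1 g.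
Proof.
move=> fD fZ fM f1 gD gZ gM g1 fg p.
have f0 : f 0 = 0 by have := fZ 0 0; rewrite !scale0r.
have g0 : g 0 = 0 by have := gZ 0 0; rewrite !scale0r.
rewrite (mpoly.mpolyE p) (big_morph f fD f0) (big_morph g gD g0).
apply: eq_bigr => m _; rewrite fZ gZ mpoly.mpolyXE_id; congr (_ *: _).
rewrite (big_morph f fM f1) (big_morph g gM g1); apply: eq_bigr => i _.
by elim: (m i) => [|l IHl]; rewrite ?expr0 ?f1 ?g1 // !exprS fM gM IHl fg.
Qed.

Lemma poly_act_1 A : poly_act A 1 = 1.
Proof. exact: rmorph1. Qed.

(** Substitution reverses the right action on row vectors, so the group acts on polynomials from the
    left. *)
Lemma poly_act_comp A B p : poly_act A (poly_act B p) = poly_act (A *m B) p.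
Proof.
apply: (cpoly_morph_ext (f := fun q => poly_act A (poly_act B q))).
- by move=> u v; rewrite (poly_actD B) (poly_actD A).
- by move=> c u; rewrite (poly_actZ B) (poly_actZ A).
- by move=> u v; rewrite (poly_actM B) (poly_actM A).
- by rewrite (poly_act_1 B) poly_act_1.
- exact: poly_actD.
- exact: poly_actZ.
- exact: poly_actM.
- exact: poly_act_1.
move=> j; rewrite (poly_actX B) (poly_actX (A *m B)) poly_act_sum.
under eq_bigr do rewrite poly_actZ poly_actX scaler_sumr.
rewrite exchange_big /=; apply: eq_bigr => i _.
by rewrite mxE scaler_suml; apply: eq_bigr => l _; rewrite scalerA mulrC.
Qed.

Lemma poly_act1 p : poly_act 1%:M p = p.
Proof.
apply: (cpoly_morph_ext (f := poly_act 1%:M) (g := id)) => //.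
- exact: poly_actD.
- exact: poly_actZ.
- exact: poly_actM.
- exact: poly_act_1.
move=> j; rewrite poly_actX (bigD1 j) //= big1 ?addr0 => [|i ij].
  by rewrite mxE eqxx scale1r.
by rewrite mxE (negbTE ij) scale0r.
Qed.

Lemma homog_prod (k : nat) (F : 'I_k -> cpoly R N) (d : 'I_k -> nat) :
  (forall i, F i \is homog (d i)) -> \prod_i F i \is homog (\sum_i d i)%N.
Proof.
move=> HF; elim/big_rec2: _ => [|i e q _ Hq]; first exact: mpoly.dhomog1.
exact: mpoly.dhomogM.
Qed.

Lemma poly_actX_homog A j : poly_act A 'Y_j \is homog 1.
Proof.
rewrite poly_actX; apply: rpred_sum => i _; apply: rpredZ.
by rewrite mpoly.dhomogX /= mpoly.mdeg1.
Qed.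

Lemma poly_act_homog A p d : p \is homog d -> poly_act A p \is homog d.
Proof.
move=> /mpoly.dhomogP Hp; rewrite /poly_act mpoly.comp_mpolyEX big_seq.
apply: rpred_sum => m mp; apply: rpredZ.
have := Hp m mp; rewrite /= mpoly.mdegE => <-; rewrite mpoly.comp_mpolyX.
apply: homog_prod => i; rewrite tnth_mktuple -poly_actX.
by have := mpoly.dhomogMn (m i) (poly_actX_homog A i); rewrite mul1n.
Qed.

Lemma ev_homog p d (c : R[i]) x : p \is homog d -> ev p (c *: x) = c ^+ d * ev p x.
Proof.
move=> /mpoly.dhomogP Hp; rewrite /ev !mpoly.mevalE mulr_sumr !big_seq.
apply: eq_bigr => m mp; rewrite mulrCA; congr (_ * _).
under eq_bigr do rewrite mxE exprMn.
rewrite big_split /= -expr_sum; congr (c ^+ _ * _).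
by rewrite -(Hp m mp) /= mpoly.mdegE.
Qed.

End PolynomialAction.

Section Subalgebra.

Variables (R : realType) (N m : nat) (s : 'I_m -> cpoly R N).

Definition in_subalg (p : cpoly R N) := exists q, p = subst s q.

Lemma in_subalg_var j : in_subalg (s j).
Proof.
by exists 'Y_j; rewrite /subst mpoly.comp_mpolyXU -tnth_nth tnth_mktuple.
Qed.

Lemma in_subalgC c : in_subalg (mpoly.mpolyC N c).
Proof. by exists (mpoly.mpolyC m c); rewrite /subst mpoly.comp_mpolyC. Qed.

Lemma in_subalg0 : in_subalg 0.
Proof. by exists 0; rewrite /subst raddf0. Qed.

Lemma in_subalgD p q : in_subalg p -> in_subalg q -> in_subalg (p + q).
Proof. by move=> [u ->] [v ->]; exists (u + v); rewrite /subst raddfD. Qed.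

Lemma in_subalgZ c p : in_subalg p -> in_subalg (c *: p).
Proof. by move=> [u ->]; exists (c *: u); rewrite /subst linearZ. Qed.

Lemma in_subalgM p q : in_subalg p -> in_subalg q -> in_subalg (p * q).
Proof. by move=> [u ->] [v ->]; exists (u * v); rewrite /subst rmorphM. Qed.

Lemma in_subalg_sum (I : Type) (r : seq I) (P : pred I) (F : I -> cpoly R N) :
  (forall i, P i -> in_subalg (F i)) -> in_subalg (\sum_(i <- r | P i) F i).
Proof.
by move=> HF; elim/big_rec: _ => [|i p Pi]; [exact: in_subalg0 | apply: in_subalgD; exact: HF].
Qed.

Lemma in_subalgX p k : in_subalg p -> in_subalg (p ^+ k).
Proof.
move=> gp; elim: k => [|k IHk]; first by rewrite expr0 -mpoly.mpolyC1; apply: in_subalgC.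
by rewrite exprS; apply: in_subalgM.
Qed.

Lemma in_subalg_subst k (u : 'I_k -> cpoly R N) q :
  (forall j, in_subalg (u j)) -> in_subalg (subst u q).
Proof.
move=> gu; rewrite /subst mpoly.comp_mpolyE; apply: in_subalg_sum => a _.
apply: in_subalgZ; elim/big_rec: _ => [|i p _ gp].
  by rewrite -mpoly.mpolyC1; apply: in_subalgC.
by apply: in_subalgM gp; rewrite tnth_mktuple; apply: in_subalgX.
Qed.

End Subalgebra.

(** * Averaging over the group and orbit polynomials *)

Section Reynolds.

Variables (F : fieldType) (A : comAlgType F) (gT : finGroupType) (H : {group gT}).
Variable act : gT -> {rmorphism A -> A}.
Hypothesis actZ : forall g c p, act g (c *: p) = c *: act g p.
Hypothesis act1 : forall p, act 1%g p = p.
Hypothesis act_comp : forall g h p, g \in H -> h \in H ->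
  act g (act h p) = act (g * h)%g p.
Hypothesis card_neq0 : #|H|%:R != 0 :> F.

Local Notation k := #|H|.
Local Notation inv p := (forall g, g \in H -> act g p = p).

Implicit Types p q : A.

Lemma orbit_prod_inv p : inv (\prod_(g in H) act g p).
Proof.
move=> h Hh; rewrite rmorph_prod [RHS](reindex_inj (mulgI h)) /=.
by apply: eq_big => [g|g Hg]; rewrite ?groupMl // act_comp.
Qed.

Definition reynolds p : A := k%:R^-1 *: \sum_(g in H) act g p.

Lemma reynolds_inv p : inv (reynolds p).
Proof.
move=> h Hh; rewrite actZ raddf_sum [in RHS]/reynolds; congr (_ *: _).
rewrite [RHS](reindex_inj (mulgI h)) /=.
by apply: eq_big => [g|g Hg]; rewrite ?groupMl // act_comp.
Qed.

Lemma reynolds_id p : inv p -> reynolds p = p.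
Proof.
move=> pH; rewrite /reynolds (eq_bigr (fun=> p)) => [|g Hg]; last exact: pH.
by rewrite sumr_const -scaler_nat scalerA mulVf // scale1r.
Qed.

Lemma reynolds_mull p q : inv p -> reynolds (p * q) = p * reynolds q.
Proof.
move=> pH; rewrite /reynolds -scalerAr mulr_sumr; congr (_ *: _).
by apply: eq_bigr => g Hg; rewrite rmorphM pH.
Qed.

Lemma reynolds_sum (I : Type) (r : seq I) (P : pred I) (f : I -> A) :
  reynolds (\sum_(i <- r | P i) f i) = \sum_(i <- r | P i) reynolds (f i).
Proof.
rewrite /reynolds -scaler_sumr; congr (_ *: _); rewrite exchange_big /=.
by apply: eq_bigr => g _; rewrite raddf_sum.
Qed.

Lemma reynoldsZ c p : reynolds (c *: p) = c *: reynolds p.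
Proof.
rewrite /reynolds scalerA [c * _]mulrC -scalerA [in RHS]scaler_sumr; congr (_ *: _).
by apply: eq_bigr => g _; rewrite actZ.
Qed.

(** Up to sign its coefficients are the elementary symmetric functions of the translates of [p]. The
    factor of the identity makes [p] a root, which gives an integral equation over the
    invariants. *)
Definition orbit_poly p : {poly A} := \prod_(g <- enum H) ('X - (act g p)%:P).

Lemma orbit_poly_inv p j : inv (orbit_poly p)`_j.
Proof.
move=> h Hh; suff E : map_poly (act h) (orbit_poly p) = orbit_poly p.
  by rewrite -coef_map E.
rewrite /orbit_poly !big_enum /=.
rewrite rmorph_prod [RHS](reindex_inj (mulgI h)) /=.
apply: eq_big => [g|g Hg]; first by rewrite groupMl.
by rewrite rmorphB /= map_polyX map_polyC /= act_comp.
Qed.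

Lemma orbit_poly_relation p : p ^+ k = - \sum_(j < k) (orbit_poly p)`_j * p ^+ j.
Proof.
have sz : size (orbit_poly p) = k.+1 by rewrite size_prod_XsubC -cardE.
have root0 : (orbit_poly p).[p] = 0.
  rewrite /orbit_poly big_enum /= (bigD1 1%g) //= hornerM hornerXsubC.
  by rewrite act1 subrr mul0r.
have monP : orbit_poly p \is monic by apply: monic_prod_XsubC.
have := root0; rewrite horner_coef sz big_ord_recr /=.
move: monP; rewrite monicE lead_coefE sz /= => /eqP ->.
by rewrite mul1r addrC => /eqP; rewrite addr_eq0 => /eqP.
Qed.

(** By induction on the list of factors; beyond the degree the truncated [k - j] is harmless,
    because [0] is homogeneous of every degree. *)
Lemma orbit_poly_graded (hom : nat -> A -> Prop) p :
  (forall d, hom d 0) -> hom 0%N 1 -> (forall d u v, hom d u -> hom d v -> hom d (u - v)) ->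
  (forall d e u v, hom d u -> hom e v -> hom (d + e)%N (u * v)) ->
  (forall g, hom 1%N (act g p)) -> forall j, hom (k - j)%N (orbit_poly p)`_j.
Proof.
move=> hom0 hom1 homB homM homp j; rewrite /orbit_poly cardE.
elim: (enum H) j => [|g r IHr] j; first by rewrite big_nil coef1; case: j.
have sz : size (\prod_(g <- r) ('X - (act g p)%:P)) = (size r).+1.
  by rewrite size_prod_XsubC.
rewrite big_cons mulrBl coefB coefXM coefCM; apply: homB.
  by case: j => [|j] //=; rewrite subSS.
have [jr|rj] := leqP j (size r); first by rewrite /= subSn // -add1n; apply: homM.
by rewrite [_`_j]nth_default ?mulr0 // sz.
Qed.

Variables (N : nat) (x : 'I_N -> A).

Definition monom (e : {ffun 'I_N -> nat}) : A := \prod_i x i ^+ e i.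

Definition upd (e : {ffun 'I_N -> nat}) i a := [ffun j => if j == i then a else e j].

Lemma monom_upd e i a : monom (upd e i a) = x i ^+ a * \prod_(j | j != i) x j ^+ e j.
Proof.
rewrite /monom (bigD1 i) //= ffunE eqxx; congr (_ * _).
by apply: eq_bigr => j /negbTE ji; rewrite ffunE ji.
Qed.

Lemma sum_upd e i a : (\sum_j upd e i a j = a + \sum_(j | j != i) e j)%N.
Proof.
rewrite (bigD1 i) //= ffunE eqxx; congr (_ + _)%N.
by apply: eq_bigr => j /negbTE ji; rewrite ffunE ji.
Qed.

Lemma upd_id e i : upd e i (e i) = e.
Proof. by apply/ffunP => j; rewrite ffunE; case: eqP => // ->. Qed.

(* The relation [orbit_poly_relation] lowers an exponent [e i >= k], so every
   averaged monomial is a combination of those with all exponents below [k]. *)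
Lemma reynolds_monom_generated (gen : A -> Prop) :
  gen 0 -> (forall p q, gen p -> gen q -> gen (p + q)) ->
  (forall c p, gen p -> gen (c *: p)) -> (forall p q, gen p -> gen q -> gen (p * q)) ->
  (forall i j, (j < k)%N -> gen (orbit_poly (x i))`_j) ->
  (forall e : {ffun 'I_N -> 'I_k}, gen (reynolds (monom [ffun i => val (e i)]))) ->
  forall e, gen (reynolds (monom e)).
Proof.
move=> gen0 genD genZ genM gen_orbit gen_box e.
have [n] := ubnP (\sum_i e i)%N; elim: n e => // n IHn e en.
have [/forallP small|] := boolP [forall i, (e i < k)%N].
  have := gen_box [ffun i => Ordinal (small i)].
  by congr (gen (reynolds (monom _))); apply/ffunP => i; rewrite !ffunE.
(* The power [x l ^+ k] is split off and rewritten by lower powers with invariant coefficients,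
   which pass through the average; the total degree of the remaining monomials drops. *)
rewrite negb_forall => /existsP[l]; rewrite -leqNgt => kl.
rewrite -(upd_id e l) -(subnK kl) monom_upd addnC exprD orbit_poly_relation.
rewrite mulNr mulNr mulr_suml mulr_suml -scaleN1r reynoldsZ reynolds_sum.
apply: genZ; apply: big_ind => // j _.
rewrite -!mulrA reynolds_mull; last exact: orbit_poly_inv.
apply: genM; first exact: gen_orbit.
rewrite mulrA -exprD -monom_upd; apply: IHn.
rewrite sum_upd; apply: (@leq_trans (\sum_i e i)%N); last by rewrite -ltnS.
by rewrite [leqRHS](bigD1 l) //= ltn_add2r -{2}(subnKC kl) ltn_add2r.
Qed.

End Reynolds.

(** * Noether's finiteness theorem *)

Section Noether.

Variables (R : realType) (gT : finGroupType) (G : {group gT}) (N : nat).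
Variable rho : mx_representation R[i] G N.
Variable H : {group gT}.
Hypothesis sHG : H \subset G.

Implicit Types (p q : cpoly R N) (g h : gT).

Definition pact (g : gT) : {rmorphism cpoly R N -> cpoly R N} :=
  GRing.RMorphism.clone _ _ (poly_act (rho g)) _.

Lemma pactE g p : pact g p = poly_act (rho g) p.
Proof. by []. Qed.

Lemma pactZ g c p : pact g (c *: p) = c *: pact g p.
Proof. exact: poly_actZ. Qed.

Lemma pact1 p : pact 1%g p = p.
Proof. by rewrite pactE repr_mx1 poly_act1. Qed.

Lemma pact_comp g h p : g \in H -> h \in H -> pact g (pact h p) = pact (g * h)%g p.
Proof.
move=> Hg Hh; rewrite -[LHS]/(poly_act (rho g) (poly_act (rho h) p)) pactE.
by rewrite poly_act_comp repr_mxM ?(fintype.subsetP sHG).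
Qed.

Let card_neq0 : #|H|%:R != 0 :> R[i].
Proof. by rewrite pnatr_eq0 -lt0n cardG_gt0. Qed.

Lemma invariant_orbit_prod p : Defs.invariant rho H (\prod_(g in H) poly_act (rho g) p).
Proof. exact: (orbit_prod_inv pact_comp). Qed.

(** Left summand: the lower coefficients of the orbit polynomials of the variables. Right summand:
    the averages of the monomials with all exponents below the group order. *)
Definition noether_index : finType :=
  ('I_N * 'I_#|H| + {ffun 'I_N -> 'I_#|H|})%type.

Local Notation Y := (fun i : 'I_N => 'Y_i : cpoly R N).

Definition noether_gen (a : noether_index) : cpoly R N :=
  match a with
  | inl ij => (orbit_poly H pact (Y ij.1))`_ij.2
  | inr e => reynolds H pact (monom Y [ffun i => val (e i)])
  end.

Lemma homog_reynolds p d : p \is homog d -> reynolds H pact p \is homog d.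
Proof.
move=> Hp; apply: rpredZ; apply: rpred_sum => g _; exact: poly_act_homog.
Qed.

Lemma homog_monom e : monom Y e \is homog (\sum_i e i)%N.
Proof.
apply: homog_prod => l; have := @mpoly.dhomogMn N R[i] _ 1 ('Y_l) (e l).
by rewrite mul1n; apply; rewrite mpoly.dhomogX /= mpoly.mdeg1.
Qed.

Lemma homog_noether_gen a : is_homogeneous (noether_gen a).
Proof.
case: a => [[l j]|e] /=; last first.
  by exists (\sum_i [ffun i => val (e i)] i)%N; apply/homog_reynolds/homog_monom.
exists (#|H| - j)%N.
apply: (@orbit_poly_graded _ _ _ H pact (fun d p => p \is homog d)) => [d||d u v|d e u v|g].
- exact: rpred0.
- exact: mpoly.dhomog1.
- exact: rpredB.
- exact: mpoly.dhomogM.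
- exact: poly_actX_homog.
Qed.

(** An invariant equals its own average, hence is a linear combination of averaged monomials. *)
Lemma noether_generates : exists m (s : 'I_m -> cpoly R N),
  [/\ forall j, is_homogeneous (s j), forall j, Defs.invariant rho H (s j)
    & forall p, Defs.invariant rho H p -> in_subalg s p].
Proof.
pose s (j : 'I_(#|{: noether_index}|)) := noether_gen (enum_val j).
have gen a : in_subalg s (noether_gen a).
  by have := in_subalg_var s (enum_rank a); rewrite /s enum_rankK.
exists _, s; split=> [j|j|p pH].
- exact: homog_noether_gen.
- rewrite /s; case: (enum_val j) => [[l a]|e] /=.
    exact: (orbit_poly_inv pact_comp).
  exact: (reynolds_inv pactZ pact_comp).
have gmon e : in_subalg s (reynolds H pact (monom Y e)).
  apply: (reynolds_monom_generated pactZ pact1 pact_comp (x := Y) (gen := in_subalg s)).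
  - exact: in_subalg0.
  - exact: in_subalgD.
  - exact: in_subalgZ.
  - exact: in_subalgM.
  - by move=> l j jk; apply: (gen (inl (l, Ordinal jk))).
  - by move=> e'; apply: (gen (inr e')).
have <- := reynolds_id card_neq0 (act := pact) pH.
rewrite (mpoly.mpolyE p) (reynolds_sum _ pact); apply: in_subalg_sum => m _.
rewrite (reynoldsZ _ pactZ); apply: in_subalgZ.
have := gmon [ffun l => m l]; rewrite /monom.
rewrite (eq_bigr (fun l => 'Y_l ^+ m l)) => [|l _]; last by rewrite ffunE.
by rewrite -mpoly.mpolyXE_id.
Qed.

(** A homogeneous generating family of least cardinality is minimal: a generator lying in the
    subalgebra of the others could be dropped. *)
Lemma min_hom_gen_exists : exists m (s : 'I_m -> cpoly R N), min_hom_gen rho H s.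
Proof.
pose good m (s : 'I_m -> cpoly R N) :=
  [/\ forall j, is_homogeneous (s j), forall j, Defs.invariant rho H (s j)
    & forall p, Defs.invariant rho H p -> in_subalg s p].
have ex : exists m, `[< exists s, @good m s >].
  by have [m [s Hs]] := noether_generates; exists m; apply/asboolP; exists s.
case: (ex_minnP ex) => m /asboolP[s [s_hom s_inv s_gen]] m_min.
exists m, s; split=> // j [q Hq].
case: m s s_hom s_inv s_gen m_min j q Hq => [|m] s s_hom s_inv s_gen m_min j q Hq.
  by case: j Hq.
suff /m_min : `[< exists s, @good m s >] by rewrite ltnn.
pose s' a := s (lift j a).
have gen_other a : a != j -> in_subalg s' (s a).
  move=> aj; have [b ab _] : {b | a = lift j b & unlift j a = Some b}.
    by apply: unlift_some; rewrite eq_sym.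
  by rewrite ab; apply: in_subalg_var.
apply/asboolP; exists s'; split=> [a|a|p /s_gen[u ->]]; [exact: s_hom | exact: s_inv |].
apply: in_subalg_subst => a; have [->|] := eqVneq a j; last exact: gen_other.
rewrite Hq; apply: in_subalg_subst => b; case: ifPn => [_|]; last exact: gen_other.
exact: in_subalg0.
Qed.

End Noether.

(** * Continuity of polynomial maps *)

Section Continuity.

Variables (R : realType) (k : nat) (x : 'rV[R[i]]_k).

Definition vcont (f : 'rV[R[i]]_k -> R[i]) := forall e : R, 0 < e ->
  exists2 d : R, 0 < d & forall y, vclose d y x -> cabs (f y - f x) < e.

Lemma vclose_le (d d' : R) (y z : 'rV[R[i]]_k) : d <= d' -> vclose d y z -> vclose d' y z.
Proof. by move=> dd' yz l; apply: lt_le_trans (yz l) dd'. Qed.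

Lemma vcont_cst c : vcont (fun=> c).
Proof. by move=> e e0; exists 1 => // y _; rewrite subrr cabs0. Qed.

Lemma vcont_coord l : vcont (fun y => y 0 l).
Proof. by move=> e e0; exists e => // y; apply. Qed.

Lemma vcontD f g : vcont f -> vcont g -> vcont (fun y => f y + g y).
Proof.
move=> cf cg e e0; have e20 : 0 < e / 2 by lra.
have [d1 d10 Hd1] := cf _ e20; have [d2 d20 Hd2] := cg _ e20.
exists (Num.min d1 d2) => [|y yx]; first by rewrite lt_min d10.
have m1 : Num.min d1 d2 <= d1 by rewrite ge_min lexx.
have m2 : Num.min d1 d2 <= d2 by rewrite ge_min lexx orbT.
have fy := Hd1 y (vclose_le m1 yx).
have gy := Hd2 y (vclose_le m2 yx).
by rewrite opprD addrACA; apply: le_lt_trans (cabsD _ _) _; lra.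
Qed.

Lemma vcontM f g : vcont f -> vcont g -> vcont (fun y => f y * g y).
Proof.
move=> cf cg e e0; set a := cabs (f x); set b := cabs (g x).
have a0 : 0 <= a by apply: cabs_ge0.
have b0 : 0 <= b by apply: cabs_ge0.
have C0 : 0 < 2 * (1 + a + b) by lra.
have e10 : 0 < Num.min 1 (e / (2 * (1 + a + b))) by rewrite lt_min ltr01 divr_gt0.
set e1 := Num.min _ _ in e10.
have e11 : e1 <= 1 by rewrite ge_min lexx.
have e12 : e1 * (1 + a + b) < e.
  have : e1 <= e / (2 * (1 + a + b)) by rewrite ge_min lexx orbT.
  by rewrite ler_pdivlMr //; nra.
have [d1 d10 Hd1] := cf _ e10; have [d2 d20 Hd2] := cg _ e10.
exists (Num.min d1 d2) => [|y yx]; first by rewrite lt_min d10.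
have m1 : Num.min d1 d2 <= d1 by rewrite ge_min lexx.
have m2 : Num.min d1 d2 <= d2 by rewrite ge_min lexx orbT.
have fy := Hd1 y (vclose_le m1 yx).
have gy := Hd2 y (vclose_le m2 yx).
have -> : f y * g y - f x * g x = (f y - f x) * (g y - g x) + (f y - f x) * g x
    + f x * (g y - g x) by ring.
apply: le_lt_trans (cabsD _ _) _; have := cabsD ((f y - f x) * (g y - g x)) ((f y - f x) * g x).
rewrite !cabsM -/a -/b; have := cabs_ge0 (f y - f x); have := cabs_ge0 (g y - g x).
move: (cabs (f y - f x)) (cabs (g y - g x)) (cabs _) fy gy => u v w fy gy v0 u0; nra.
Qed.

Lemma vcont_ev (p : cpoly R k) : vcont (ev p).
Proof.
suff : vcont (fun y => \sum_(m <- mpoly.msupp p) mpoly.mcoeff m p * \prod_l y 0 l ^+ m l).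
  by move=> cp e e0; have [d d0 Hd] := cp e e0; exists d.
elim: (mpoly.msupp p : seq _) => [|m r IHr].
  move=> e e0; exists 1 => // y _; by rewrite !big_nil subrr cabs0.
suff cm : vcont (fun y => mpoly.mcoeff m p * \prod_l y 0 l ^+ m l).
  move=> e e0; have [d d0 Hd] := vcontD cm IHr e0; exists d => // y /Hd.
  by rewrite !big_cons.
apply: vcontM; first exact: vcont_cst.
elim: (index_enum _) => [|l s IHs].
  move=> e e0; exists 1 => // y _; by rewrite !big_nil subrr cabs0.
suff cl : vcont (fun y => y 0 l ^+ m l).
  move=> e e0; have [d d0 Hd] := vcontM cl IHs e0; exists d => // y /Hd.
  by rewrite !big_cons.
elim: (m l) => [|a IHa]; first exact: vcont_cst.
move=> e e0; have [d d0 Hd] := vcontM (vcont_coord l) IHa e0; exists d => // y /Hd.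
by rewrite !exprS.
Qed.

Lemma polymap_continuous m (s : 'I_m -> cpoly R k) (e : R) : 0 < e ->
  exists2 d : R, 0 < d & forall y, vclose d y x -> vclose e (polymap s y) (polymap s x).
Proof.
move=> e0; have [d d0 Hd] : exists2 d : R, 0 < d & forall j, forall y, vclose d y x ->
    cabs (ev (s j) y - ev (s j) x) < e.
  apply: finite_radius => [j d d' /andP[_ dd'] Hd y yx | j]; last exact: vcont_ev.
  exact/Hd/(vclose_le dd').
by exists d => // y yx j; rewrite !polymapE; apply: Hd.
Qed.

End Continuity.

(** Each of many linear forms will be small on some translate; this finds [N] of them that are small
    on the same translate. *)
Lemma pigeonhole_fiber (T : finType) (A : {set T}) (N M : nat) (f : 'I_M -> T) :
  (#|A| * N < M)%N -> (forall t, f t \in A) ->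
  exists2 a, a \in A & exists c : {ffun 'I_N -> 'I_M},
    injective c /\ forall j, f (c j) = a.
Proof.
move=> AM fA; suff [a Aa big] : exists2 a, a \in A & (N < #|[set t | f t == a]|)%N.
  exists a => //; pose c j := enum_val (widen_ord (ltnW big) j).
  exists [ffun j => c j]; split=> [j1 j2|j]; last first.
    by have := enum_valP (widen_ord (ltnW big) j); rewrite inE ffunE => /eqP.
  by rewrite !ffunE => /enum_val_inj/(congr1 val) /= /val_inj.
apply: contrapT => no.
have : (\sum_(t : 'I_M) 1 <= #|A| * N)%N.
  rewrite (partition_big f (mem A)) //= -sum_nat_const; apply: leq_sum => a Aa.
  rewrite sum1dep_card leqNgt; apply/negP => big; apply: no; exists a => //.
by rewrite sum1_card card_ord leqNgt AM.
Qed.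

Lemma det_Vandermonde_nat (R : realType) (N M : nat) (c : 'I_N -> 'I_M) : injective c ->
  Vandermonde N (\row_j (c j)%:R : 'rV[R[i]]_N) \in unitmx.
Proof.
move=> c_inj; rewrite unitmxE det_Vandermonde unitfE.
apply/prodf_neq0 => i _; apply/prodf_neq0 => j ij.
rewrite !mxE subr_eq0 eqr_nat; apply/eqP => /val_inj/c_inj E.
by rewrite E ltnn in ij.
Qed.

(** * Invariants control the distance of orbits *)

Section OrbitSpace.

Variables (R : realType) (gT : finGroupType) (G : {group gT}) (N : nat).
Variable rho : mx_representation R[i] G N.
Variable H : {group gT}.
Hypothesis sHG : H \subset G.
Variables (m : nat) (tau : 'I_m -> cpoly R N).
Hypothesis tau_inv : forall j, Defs.invariant rho H (tau j).
Hypothesis tau_gen : forall p, Defs.invariant rho H p -> in_subalg tau p.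

(** The coefficients run along the moment curve, so any [N] of these forms with distinct [t] are a
    basis of the dual space, by the Vandermonde determinant. *)
Definition form (t : nat) : cpoly R N := \sum_(i < N) (t%:R ^+ i) *: 'Y_i.

Lemma ev_form t (x : 'rV[R[i]]_N) : ev (form t) x = \sum_(i < N) x 0 i * t%:R ^+ i.
Proof.
rewrite /ev /form raddf_sum /=; apply: eq_bigr => i _.
by rewrite mpoly.mevalZ mpoly.mevalXU mulrC.
Qed.

Lemma ev_formB t (x y : 'rV[R[i]]_N) : ev (form t) (x - y) = ev (form t) x - ev (form t) y.
Proof.
by rewrite !ev_form -sumrB; apply: eq_bigr => i _; rewrite !mxE mulrBl.
Qed.

(** Inverting the Vandermonde system recovers [z] from [N] of the forms. There are finitely many
    choices of indices below [M], whose constants are summed to get one [C]. *)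
Lemma forms_bound (M : nat) : exists2 C : R, 0 < C &
  forall (c : {ffun 'I_N -> 'I_M}) (z : 'rV[R[i]]_N) (e : R), injective c -> 0 < e ->
    (forall j, cabs (ev (form (c j)) z) < e) -> inorm rho z <= C * e.
Proof.
have [K K0 HK] := inorm_le_vnorm rho.
pose V (c : {ffun 'I_N -> 'I_M}) := Vandermonde N (\row_j (c j)%:R : 'rV[R[i]]_N).
pose D c := sval (cid2 (vnorm_mulmx (invmx (V c)))).
have D_gt0 c : 0 < D c by rewrite /D; case: cid2.
have D_le c x : vnorm (x *m invmx (V c)) <= D c * vnorm x by rewrite /D; case: cid2.
have SD0 : 0 <= \sum_c D c by apply: sumr_ge0 => c _; apply: ltW.
exists (K * ((1 + \sum_c D c) * (1 + N%:R))).
  rewrite !mulr_gt0 //; first by lra.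
  by rewrite ltr_pwDl.
move=> c z e c_inj e0 ze; set u := z *m V c.
have ue : vnorm u <= N%:R * e.
  rewrite mulr_natl -[N in leRHS]card_ord -sumr_const; apply: ler_sum => j _.
  apply/ltW; have -> : u 0 j = ev (form (c j)) z; last exact: ze.
  by rewrite ev_form mxE; apply: eq_bigr => i _; rewrite !mxE.
have zu : z = u *m invmx (V c) by rewrite /u mulmxK // det_Vandermonde_nat.
apply: le_trans (HK z) _; rewrite -!mulrA ler_pM2l // {1}zu.
apply: le_trans (D_le c u) _.
have N0 : 0 <= N%:R :> R by [].
have Dc : D c <= 1 + \sum_c D c.
  rewrite (bigD1 c) //= addrCA lerDl addr_ge0 //.
  by apply: sumr_ge0 => c' _; apply: ltW.
apply: ler_pM => //; [exact: ltW | exact: vnorm_ge0 | ].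
by apply: le_trans ue _; rewrite mulrDl mul1r lerDr ltW.
Qed.

(* The product over [H] of the translates of a linear form that vanishes at [x]
   is an invariant; if it is small at [y], some translate is small. Enough
   forms in general position select one translate of [y] close to [x]. *)
Lemma orbit_close (x : 'rV[R[i]]_N) (e : R) : 0 < e -> exists2 d : R, 0 < d &
  forall y, vclose d (polymap tau y) (polymap tau x) ->
  exists2 g, g \in H & inorm rho (y *m rho g - x) < e.
Proof.
(* One more than [#|H| * N], so that [N] forms share a group element. *)
move=> e0; pose M := (#|H| * N).+1.
have [C C0 HC] := forms_bound M.
pose e1 := e / (2 * C); have e10 : 0 < e1 by rewrite divr_gt0 // mulr_gt0.
have Ce1 : C * e1 < e.
  have -> : C * e1 = e / 2 by rewrite /e1; field; rewrite gt_eqF.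
  by lra.
pose p (t : 'I_M) := \prod_(g in H)
  poly_act (rho g) (mpoly.mpolyC N (ev (form t) x) - form t).
have ev_p t y : ev (p t) y = \prod_(g in H) ev (form t) (x - y *m rho g).
  rewrite ev_prod; apply: eq_bigr => g _.
  by rewrite ev_poly_act ev_formB evB evC.
(* A product of [#|H|] moduli below [e1 ^+ #|H|] has a factor below [e1]. *)
have [d d0 Hd] : exists2 d : R, 0 < d & forall t : 'I_M, forall y,
    vclose d (polymap tau y) (polymap tau x) -> cabs (ev (p t) y) < e1 ^+ #|H|.
  apply: finite_radius => [t d d' /andP[_ dd'] Hd y yx|t].
    exact/Hd/(vclose_le dd').
  have [q Hq] := tau_gen (invariant_orbit_prod rho sHG
    (mpoly.mpolyC N (ev (form t) x) - form t)).
  have [d d0 Hd] := @vcont_ev _ _ (polymap tau x) q _ (exprn_gt0 #|H| e10).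
  exists d => // y /Hd; rewrite -!ev_subst -Hq -/(p t).
  have -> : ev (p t) x = 0; last by rewrite subr0.
  rewrite ev_p (bigD1 1%g) //= repr_act1 subrr -[X in X * _]/(ev _ _).
  have -> : ev (form t) 0 = 0 by rewrite ev_form big1 // => i _; rewrite mxE mul0r.
  by rewrite mul0r.
exists d => // y yx.
have small (t : 'I_M) : exists2 g, g \in H & cabs (ev (form t) (x - y *m rho g)) < e1.
  apply: contrapT => no; have := Hd t y yx; rewrite ev_p cabs_prod.
  rewrite ltNge => /negP; apply; rewrite -prodr_const; apply: ler_prod => g Hg.
  rewrite ltW //= leNgt; apply/negP => lt; apply: no; by exists g.
pose gam t := sval (cid2 (small t)).
have gamH t : gam t \in H by rewrite /gam; case: cid2.
have game (t : 'I_M) : cabs (ev (form t) (x - y *m rho (gam t))) < e1 by rewrite /gam; case: cid2.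
have [g Hg [c [c_inj cg]]] := pigeonhole_fiber (ltnSn _) gamH.
exists g => //; rewrite inormB; apply: le_lt_trans Ce1.
by apply: HC c_inj e10 _ => j; rewrite -(cg j).
Qed.

Lemma polymap_act x g : g \in H -> polymap tau (x *m rho g) = polymap tau x.
Proof. by move=> Hg; apply/rowP => j; rewrite !polymapE -ev_poly_act tau_inv. Qed.

(** A finite orbit that misses [x] keeps a positive distance from it, contrary to [orbit_close]. *)
Lemma orbit_separation x y : polymap tau y = polymap tau x ->
  exists2 g, g \in H & y *m rho g = x.
Proof.
move=> yx; apply: contrapT => no.
have [e e0 He] : exists2 e : R, 0 < e & forall g, g \in H -> e <= inorm rho (y *m rho g - x).
  apply: (@finite_radius _ _ (fun g (e : R) => g \in H -> e <= inorm rho (y *m rho g - x))).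
    by move=> g d d' /andP[_ dd'] Hd /Hd; apply: le_trans.
  move=> g; have [Hg|nHg] := boolP (g \in H); last by exists 1.
  exists (inorm rho (y *m rho g - x)) => //; apply: inorm_gt0 => /eqP.
  by rewrite subr_eq0 => /eqP gx; apply: no; exists g.
have [d d0 Hd] := orbit_close x e0.
have [|g Hg] := Hd y; last by rewrite ltNge He.
by move=> j; rewrite yx subrr cabs0.
Qed.

End OrbitSpace.

Lemma is_homogeneous_pdeg (R : realType) N (p : cpoly R N) :
  is_homogeneous p -> p \is homog (pdeg p).
Proof. by move=> [d /mpoly.dhomog_msize]. Qed.

Lemma ev_pdeg (R : realType) N (p : cpoly R N) c x :
  is_homogeneous p -> ev p (c *: x) = c ^+ pdeg p * ev p x.
Proof. by move=> /is_homogeneous_pdeg/ev_homog. Qed.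

(** A generator of degree zero is a constant and lies in every subalgebra, against minimality. *)
Lemma min_hom_gen_pdeg (R : realType) (gT : finGroupType) (G : {group gT}) N
  (rho : mx_representation R[i] G N) (H : {set gT}) m (tau : 'I_m -> cpoly R N) j :
  min_hom_gen rho H tau -> (0 < pdeg (tau j))%N.
Proof.
move=> [_ _ _ tau_min]; rewrite lt0n; apply/eqP => deg0; apply: (tau_min j).
have sz : (mpoly.msize (tau j) <= 1)%N.
  by move: deg0; rewrite /pdeg; case: (mpoly.msize _) => [|[]].
have [c ->] : exists c, tau j = mpoly.mpolyC N c.
  by eexists; apply: mpoly.msize1_polyC.
exact: in_subalgC.
Qed.

(** Real and imaginary parts of the coordinates stay in a product of segments, compact by Tychonoff;
    [w] is a cluster point there. *)
Lemma bolzano_weierstrass (R : realType) N (u : nat -> 'rV[R[i]]_N) (B : R) :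
  (forall n, vnorm (u n) <= B) -> exists w, forall e : R, 0 < e -> forall n0,
    exists2 n, (n0 <= n)%N & vclose e (u n) w.
Proof.
move=> uB; pose f n (k : 'I_N * bool) : R :=
  if k.2 then complex.Re (u n 0 k.1) else complex.Im (u n 0 k.1).
have fB n k : f n k \in `[(- B)%R, B].
  rewrite in_itv /= -ler_norml; apply: le_trans (uB n).
  apply: le_trans (cabs_le_vnorm (u n) k.1).
  by rewrite /f; case: ifP => _; [apply: ler_Re_cabs | apply: ler_Im_cabs].
have comp := @tychonoff _ (fun=> R) (fun=> `[(- B)%R, B]%classic)
  (fun k : 'I_N * bool => @segment_compact R (- B) B).
have [p [_ clp]] := comp (f @ \oo)%classic _ (filterE _ fB).
exists (\row_l (complex.Complex (p (l, true)) (p (l, false)))) => e e0 n0.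
have e20 : 0 < e / 2 by lra.
have nb : nbhs p [set q | forall k, `|q k - p k| < e / 2]%classic.
  apply: (@filter_forall _ _ (fun k q => `|q k - p k| < e / 2) (nbhs p)) => k.
  have := @proj_continuous _ (fun=> R) k p _ (nbhsx_ballx (p k) (e / 2) e20).
  apply: (@filterS _ _ (nbhs_filter p)) => q.
  by rewrite /proj /= /ball /= distrC.
have tail : (f @ \oo)%classic [set q | exists2 n, (n0 <= n)%N & q = f n]%classic.
  by exists n0 => // n /= n0n; exists n.
have [q [[n n0n ->] /= near]] := clp _ _ tail nb.
exists n => // l; rewrite !mxE; apply: le_lt_trans (cabs_ReIm _) _.
have := near (l, true); have := near (l, false); rewrite /f /=.
case: (u n 0 l) => a b /=; lra.
Qed.

Lemma inorm_vclose_lt (R : realType) (gT : finGroupType) (G : {group gT}) N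
  (rho : mx_representation R[i] G N) (x y : 'rV[R[i]]_N) (e : R) :
  inorm rho (x - y) < e -> vclose e x y.
Proof.
by move=> xy; apply: vclose_vnorm; apply: le_lt_trans xy; apply: vnorm_le_inorm.
Qed.

(** * Properness and closed image of the basic invariants *)

Section ClosedImage.

Variables (R : realType) (gT : finGroupType) (G : {group gT}) (N : nat).
Variable rho : mx_representation R[i] G N.
Variable H : {group gT}.
Hypothesis sHG : H \subset G.
Variables (m : nat) (tau : 'I_m -> cpoly R N).
Hypothesis tau_min : min_hom_gen rho H tau.

Lemma polymap0 : polymap tau 0 = 0.
Proof.
have [tau_hom _ _ _] := tau_min.
apply/rowP => j; rewrite polymapE mxE -(scale0r 0) ev_pdeg // expr0n.
by rewrite eqn0Ngt (min_hom_gen_pdeg j tau_min) mul0r.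
Qed.

(** Scaling [y] by a small [r] brings [tau] close to its value [0] at the origin; [orbit_close] at
    [0] then bounds [r y] by [1]. *)
Lemma polymap_bounded (z : 'rV[R[i]]_m) : exists2 B : R, 0 < B &
  forall y, vclose 1 (polymap tau y) z -> inorm rho y <= B.
Proof.
have [tau_hom tau_inv tau_gen _] := tau_min.
have [d d0 Hd] := orbit_close sHG tau_gen 0 (@ltr01 R).
pose M := 1 + vnorm z; have M0 : 0 < M by have := vnorm_ge0 z; rewrite /M; lra.
(* Since [r <= 1] and all degrees are positive, every power of [r] that occurs is at most [r], and
   [r * M < d]. *)
pose r := Num.min 1 (d / (2 * M)).
have r0 : 0 < r by rewrite lt_min ltr01 divr_gt0 // mulr_gt0.
have r1 : r <= 1 by rewrite ge_min lexx.
have rM : r * M < d.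
  have : r <= d / (2 * M) by rewrite ge_min lexx orbT.
  by rewrite ler_pdivlMr ?mulr_gt0 //; lra.
exists r^-1 => [|y yz]; first by rewrite invr_gt0.
have [|g Hg] := Hd ((r%:C)%C *: y).
  move=> j; rewrite polymap0 polymapE [X in _ - X]mxE subr0 ev_pdeg // cabsM cabsX cabsR gtr0_norm //.
  apply: le_lt_trans rM; apply: ler_pM; rewrite ?exprn_ge0 ?cabs_ge0 ?(ltW r0) //.
    case: (pdeg _) (min_hom_gen_pdeg j tau_min) => // l _.
    by rewrite exprS -[leRHS]mulr1 ler_pM2l // exprn_ile1 // ltW.
  have := yz j; rewrite polymapE; have := cabs_le_vnorm z j.
  by have := cabsD (ev (tau j) y - z 0 j) (z 0 j); rewrite subrK /M; lra.
rewrite subr0 -scalemxAl inormZ gtr0_norm // inorm_act ?(fintype.subsetP sHG) //.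
by rewrite mulrC -ltr_pdivlMr // mul1r => /ltW.
Qed.

(** Approximate preimages are bounded by properness; a cluster point of them is a preimage by
    continuity. *)
Lemma polymap_closed (z : 'rV[R[i]]_m) :
  (forall d : R, 0 < d -> exists y, vclose d (polymap tau y) z) ->
  exists w, polymap tau w = z.
Proof.
move=> near_z; have [B B0 HB] := polymap_bounded z.
have inv_gt0 n : 0 < n.+1%:R^-1 :> R by rewrite invr_gt0 ltr0n.
pose u n := sval (cid (near_z _ (inv_gt0 n))).
have uz n : vclose n.+1%:R^-1 (polymap tau (u n)) z by rewrite /u; case: cid.
have [|w Hw] := @bolzano_weierstrass _ _ u B.
  move=> n; apply: le_trans (vnorm_le_inorm rho _) _; apply: HB.
  by apply: vclose_le (uz n); rewrite invf_le1 ?ler1n ?ltr0n.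
exists w; apply/rowP => j; apply/eqP; rewrite -subr_eq0; apply/eqP; apply: cabs_eq0.
apply/eqP; rewrite eq_le cabs_ge0 andbT; apply/ler_addgt0Pr => e e0; rewrite add0r.
have e20 : 0 < e / 2 by lra.
have [d d0 Hd] := polymap_continuous w tau e20.
have [n0 _ Hn0] : exists2 n0, True & forall n, (n0 <= n)%N -> n.+1%:R^-1 < e / 2 :> R.
  exists (Num.truncn (2 / e)) => // n n0n.
  have := truncnS_gt (2 / e); rewrite ltr_pdivrMr // => te.
  rewrite invf_plt ?posrE ?ltr0n // invf_div ltr_pdivrMr //.
  apply: lt_le_trans te _; rewrite ler_pM2r // ler_nat.
  exact: n0n.
have [n n0n un] := Hw d d0 n0.
have := Hd _ un j; have := lt_trans (uz n j) (Hn0 n n0n).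
have := cabsD (polymap tau w 0 j - polymap tau (u n) 0 j) (polymap tau (u n) 0 j - z 0 j).
rewrite addrA subrK -(cabsN (polymap tau w 0 j - _)) opprB.
by move: (cabs _) (cabs _) (cabs _) => c1 c2 c3; lra.
Qed.

End ClosedImage.

(** * The slice theorem for finite groups *)

Section Slice.

Variables (R : realType) (gT : finGroupType) (G : {group gT}) (N : nat).
Variable rho : mx_representation R[i] G N.

Lemma isotropy_group_set v : group_set (isotropy rho v).
Proof.
apply/group_setP; split; first by rewrite inE group1 repr_act1 eqxx.
move=> g h; rewrite !inE => /andP[Gg /eqP vg] /andP[Gh /eqP vh].
by rewrite groupM //= -repr_actM // vg vh.
Qed.

Canonical isotropy_group v := Group (isotropy_group_set v).

Lemma isotropy_sub v : isotropy rho v \subset G.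
Proof. by apply/fintype.subsetP => g; rewrite inE => /andP[]. Qed.

Variables (n : nat) (sigma : 'I_n -> cpoly R N).
Hypothesis sigma_min : min_hom_gen rho G sigma.
Variables (v : 'rV[R[i]]_N) (m : nat) (tau : 'I_m -> cpoly R N).
Hypothesis tau_min : min_hom_gen rho (isotropy rho v) tau.

(** The radius is so small compared with the displacements of [v] that an element carrying [v + x]
    to [v + y], with [x] and [y] in the ball, must fix [v]. So the orbits of [G] near [v] are the
    orbits of the isotropy group on the ball. *)
Lemma luna_slice_exists : exists2 r : R, 0 < r &
  luna_slice rho sigma v tau [set x | inorm rho x < r]%classic.
Proof.
have [_ sigma_inv sigma_gen _] := sigma_min.
have [_ tau_inv tau_gen _] := tau_min.
pose K := isotropy_group v; have sKG : K \subset G := isotropy_sub v.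
have KG g : g \in isotropy rho v -> g \in G by apply: (fintype.subsetP sKG).
have Kv g : g \in isotropy rho v -> v *m rho g = v by rewrite inE => /andP[_ /eqP].
have sGG : G \subset G by [].
have [r r0 Hr] : exists2 r : R, 0 < r & forall g, g \in G -> v *m rho g <> v ->
    4 * r <= inorm rho (v *m rho g - v).
  apply: (@finite_radius _ _ (fun g (r : R) => g \in G -> v *m rho g <> v ->
    4 * r <= inorm rho (v *m rho g - v))) => [g d d' dd' Hd Hg vg | g].
    by have := Hd Hg vg; lra.
  have [vg|vg] := pselect (v *m rho g = v); first by exists 1.
  exists (inorm rho (v *m rho g - v) / 4); last by move=> _ _; lra.
  by rewrite divr_gt0 // inorm_gt0 // => /eqP; rewrite subr_eq0 => /eqP.
have slice x y g : inorm rho x < r -> inorm rho y < r -> g \in G ->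
    (v + x) *m rho g = v + y -> g \in isotropy rho v /\ x *m rho g = y.
  move=> xr yr Gg; rewrite mulmxDl => E.
  have vg : v *m rho g = v.
    apply: contrapT => /(Hr g Gg).
    have -> : v *m rho g - v = y - x *m rho g.
      rewrite -[v *m rho g](addrK (x *m rho g)) E addrAC.
      by rewrite [v + y]addrC addrK.
    have := inormD rho y (- (x *m rho g)); rewrite inormN inorm_act //; lra.
  split; first by rewrite inE Gg vg eqxx.
  by move: E; rewrite vg => /addrI.
have actv x g : g \in isotropy rho v -> (v + x) *m rho g = v + x *m rho g.
  by move=> /Kv vg; rewrite mulmxDl vg.
exists r => //; split.
- move=> x /= xr; have [C C0 HC] := inorm_vclose rho.
  have e0 : 0 < (r - inorm rho x) / (2 * C) by rewrite divr_gt0 ?subr_gt0 ?mulr_gt0.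
  exists ((r - inorm rho x) / (2 * C)) => // y /(HC _ _ _ e0).
  have -> : C * ((r - inorm rho x) / (2 * C)) = (r - inorm rho x) / 2.
    by field; rewrite gt_eqF.
  by have := inormD rho (y - x) x; rewrite subrK; lra.
- by rewrite /= inorm0.
- by move=> g /KG Gg x /=; rewrite inorm_act.
- move=> x y /= xr yr; split=> E.
    have [g Kg <-] := orbit_separation (H := K) sKG tau_gen E.
    by rewrite -actv // (polymap_act (H := G) sigma_inv) // KG.
  have [g Gg gE] := orbit_separation sGG sigma_gen E.
  have [Kg <-] := slice _ _ _ xr yr Gg gE.
  by rewrite (polymap_act (H := K) tau_inv).
split.
(* [O] is a union of balls around the points [sigma (v + x)], each so small that a preimage of a
   point in it has a translate in the ball of radius [r] around [v]. *)
- pose O (z : 'rV[R[i]]_n) := exists2 x, inorm rho x < r & exists2 d : R, 0 < d &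
    (forall y, vclose d (polymap sigma y) (polymap sigma (v + x)) ->
      exists2 g, g \in G & inorm rho (y *m rho g - (v + x)) < r - inorm rho x) /\
    vclose d z (polymap sigma (v + x)).
  exists O; split.
    move=> z [x xr [d d0 [Hd zd]]].
    have [e e0 He] : exists2 e : R, 0 < e &
        forall j, cabs (z 0 j - polymap sigma (v + x) 0 j) + e <= d.
      apply: finite_radius => [j d1 d2 /andP[_ d12] Hd1 | j]; first by lra.
      exists (d - cabs (z 0 j - polymap sigma (v + x) 0 j)); last by lra.
      by rewrite subr_gt0.
    exists e => // y yz; exists x => //; exists d => //; split=> // j.
    have := cabsD (y 0 j - z 0 j) (z 0 j - polymap sigma (v + x) 0 j).
    by rewrite addrA subrK; have := yz j; have := He j; lra.
  move=> z; split.
    move=> [x /= xr <-]; split; last by exists (v + x).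
    exists x => //; have rx : 0 < r - inorm rho x by lra.
    have [d d0 Hd] := orbit_close sGG sigma_gen (v + x) rx.
    by exists d => //; split=> // j; rewrite subrr cabs0.
  move=> [[x xr [d d0 [Hd zd]]] [w wz]].
  have [|g Gg gx] := Hd w; first by rewrite wz.
  exists (w *m rho g - v); last by rewrite addrC subrK (polymap_act (H := G) sigma_inv).
  move: gx; rewrite opprD addrA /= => gx.
  have := inormD rho (w *m rho g - v - x) x; rewrite subrK.
  by move: (inorm rho (_ - _)) (inorm rho (_ - _ - _)) gx => c1 c2 gx; lra.
- move=> x /= xr e e0.
  have [d1 d10 Hd1] := polymap_continuous (v + x) sigma e0.
  have [d d0 Hd] := orbit_close (H := K) sKG tau_gen x d10.
  exists d => // y _ /Hd[g Kg gx].
  rewrite -(polymap_act (H := G) sigma_inv (v + y) (KG _ Kg)) actv //.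
  apply: Hd1; apply: (inorm_vclose_lt (rho := rho)).
  by rewrite opprD addrACA subrr add0r.
- move=> x /= xr e e0.
  have [d1 d10 Hd1] := polymap_continuous x tau e0.
  have e10 : 0 < Num.min d1 (r - inorm rho x) by rewrite lt_min d10 subr_gt0.
  have [d d0 Hd] := orbit_close sGG sigma_gen (v + x) e10.
  exists d => // y /= yr /Hd[g Gg]; rewrite lt_min => /andP[gd1 gr].
  (* The translate of [v + y] near [v + x] also lies in the ball around [v], so by [slice] the
     translating element is in the isotropy group and leaves [tau] unchanged. *)
  pose y' := (v + y) *m rho g - v.
  have y'x : y' - x = (v + y) *m rho g - (v + x) by rewrite /y' opprD addrA.
  have y'r : inorm rho y' < r.
    have := inormD rho (y' - x) x; rewrite subrK y'x.
    by move: (inorm rho (_ - _)) (inorm rho y') gr => c1 c2 gr; lra.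
  have [|Kg yE] := slice y y' g yr y'r Gg; first by rewrite /y' [RHS]addrC subrK.
  rewrite -(polymap_act (H := K) tau_inv y Kg) yE.
  by apply: Hd1; apply: (inorm_vclose_lt (rho := rho)); rewrite y'x.
Qed.

End Slice.

(** * The lifting theorem *)

Lemma derivable_jet (R : realType) (f : R -> R) (t : R) :
  derivable f t 1 <-> exists w, forall e : R, 0 < e -> exists2 d : R, 0 < d &
    forall s, `|s - t| < d -> `|f s - f t - (s - t) * w| <= e * `|s - t|.
Proof.
split.
  move=> /cvg_ex[w /cvgrPdist_le Hw]; exists w => e e0.
  have /nbhs_ballP[d /= d0 Hd] := Hw e e0; exists d => // s sd.
  have [->|st] := eqVneq s t; first by rewrite !subrr mul0r subrr normr0 mulr0.
  have st0 : s - t != 0 by rewrite subr_eq0.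
  have := Hd (s - t); rewrite /ball /= sub0r normrN => /(_ sd st0).
  rewrite [_ *: 1]mulr1 subrK => le.
  have -> : f s - f t - (s - t) * w = (s - t) * - (w - (s - t)^-1 * (f s - f t)).
    by field.
  by rewrite normrM normrN mulrC ler_wpM2r.
move=> [w Hw]; apply/cvg_ex; exists w; apply/cvgrPdist_le => e e0.
have [d d0 Hd] := Hw e e0; apply/nbhs_ballP; exists d => //= h.
rewrite /ball /= sub0r normrN => hd h0.
have := Hd (h + t); rewrite addrK => /(_ hd) le.
rewrite [h *: 1]mulr1; have h0' : 0 < `|h| by rewrite normr_gt0.
rewrite -(ler_pM2r h0'); apply: le_trans le.
rewrite -normrM -normrN /= -[_ *: (f _ - _)]/(h^-1 * (f (h + t) - f t)).
suff -> : - ((w - h^-1 * (f (h + t) - f t)) * h) = f (h + t) - f t - h * w by [].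
by field.
Qed.

Lemma continuous_for_eps (R : realType) (f : R -> R) (s : R) :
  {for s, continuous f} <-> (forall e : R, 0 < e -> exists2 d : R, 0 < d &
    forall u, `|u - s| < d -> `|f u - f s| < e).
Proof.
split.
  move=> /cvgrPdist_lt Hf e e0; have /nbhs_ballP[d /= d0 Hd] := Hf e e0.
  exists d => // u us; have := Hd u; rewrite /ball /= distrC => /(_ us).
  by rewrite distrC.
move=> Hf; apply/cvgrPdist_lt => e e0; have [d d0 Hd] := Hf e e0.
apply/nbhs_ballP; exists d => //= u; rewrite /ball /= distrC => us.
by rewrite distrC; apply: Hd.
Qed.

Lemma oitv_interval (R : realType) (a b : \bar R) : is_interval (oitv a b).
Proof.
move=> x y [ax xb] [ay yb] z /andP[xz zy]; split.
  by apply: lt_le_trans ax _; rewrite lee_fin.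
by apply: le_lt_trans yb; rewrite lee_fin.
Qed.

Lemma oitv_open (R : realType) (a b : \bar R) : ropen (oitv a b).
Proof.
move=> t [ta tb].
have [d1 d10 Hd1] : exists2 d : R, 0 < d & forall s, `|s - t| < d -> (a < s%:E)%E.
  case: a ta => [a||] // ta; last by exists 1 => // s _; rewrite ltNyr.
  rewrite lte_fin in ta; exists (t - a); first by rewrite subr_gt0.
  by move=> s; rewrite lte_fin ltr_norml => st; lra.
have [d2 d20 Hd2] : exists2 d : R, 0 < d & forall s, `|s - t| < d -> (s%:E < b)%E.
  case: b tb => [b||] // tb; last by exists 1 => // s _; rewrite ltry.
  rewrite lte_fin in tb; exists (b - t); first by rewrite subr_gt0.
  by move=> s; rewrite lte_fin ltr_norml => st; lra.
exists (Num.min d1 d2); first by rewrite lt_min d10.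
by move=> s; rewrite lt_min => /andP[/Hd1 ? /Hd2 ?].
Qed.

Section Realification.

Variables (R : realType) (V : lmodType R[i]).

(** An alias that carries the real scalars, which keeps the real module structure apart from the
    complex one. *)
Definition realified : Type := V.

HB.instance Definition _ := GRing.Zmodule.on realified.

Definition realified_scale (r : R) (x : realified) : realified := (r%:C)%C *: (x : V).

Lemma realified_scaleA r s x :
  realified_scale r (realified_scale s x) = realified_scale (r * s) x.
Proof. by rewrite /realified_scale scalerA rmorphM. Qed.

Lemma realified_scale1 : left_id 1 realified_scale.
Proof. by move=> x; rewrite /realified_scale rmorph1 scale1r. Qed.

Lemma realified_scaleDr : right_distributive realified_scale +%R.
Proof. by move=> r x y; apply: scalerDr. Qed.

Lemma realified_scaleDl x : {morph realified_scale^~ x : r s / r + s}.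
Proof. by move=> r s; rewrite /realified_scale rmorphD; apply: scalerDl. Qed.

HB.instance Definition _ := GRing.Zmodule_isLmodule.Build R realified
  realified_scaleA realified_scale1 realified_scaleDr realified_scaleDl.

End Realification.

Section DifferentiableCurves.

Variables (R : realType) (gT : finGroupType) (G : {group gT}) (N : nat).
Variable rho : mx_representation R[i] G N.

Implicit Types (I : set R) (c F : R -> 'rV[R[i]]_N).

Lemma diff_lift_inorm I f : is_interval I -> ropen I ->
  (forall t, I t -> exists w, forall e : R, 0 < e -> exists2 d : R, 0 < d &
    forall s, I s -> `|s - t| < d -> exists2 g, g \in G &
      inorm rho (f s *m rho g - f t - ((s - t)%:C)%C *: w) <= e * `|s - t|) ->
  exists F, (forall t, I t -> exists2 g, g \in G & F t = f t *m rho g) /\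
    (forall t, I t -> exists w, forall e : R, 0 < e -> exists2 d : R, 0 < d &
       forall s, I s -> `|s - t| < d ->
         inorm rho (F s - F t - ((s - t)%:C)%C *: w) <= e * `|s - t|).
Proof.
move=> Iint Io fI.
pose V := realified 'rV[R[i]]_N.
pose act (x : V) (g : gT) : V := x *m rho g.
apply: (@diff_lift_exists R gT G V (inorm rho) act) => //.
- exact: inormD.
- exact: inormZ.
- exact: inorm_eq0.
- by move=> g r x y; rewrite /act mulmxDl -scalemxAl.
- exact: repr_act1.
- exact: repr_actM.
- exact: inorm_act.
Qed.

Lemma curve_diff_jet I c t : curve_diff I c -> I t ->
  exists w, forall e : R, 0 < e -> exists2 d : R, 0 < d &
    forall s, `|s - t| < d ->
      inorm rho (c s - c t - ((s - t)%:C)%C *: w) <= e * `|s - t|.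
Proof.
move=> cI It.
have /choice[wr Hwr] : forall l, exists w, forall e : R, 0 < e -> exists2 d : R, 0 < d &
    forall s, `|s - t| < d -> `|complex.Re (c s 0 l) - complex.Re (c t 0 l) - (s - t) * w|
      <= e * `|s - t|.
  by move=> l; apply/derivable_jet; apply: (cI l t It).1.
have /choice[wi Hwi] : forall l, exists w, forall e : R, 0 < e -> exists2 d : R, 0 < d &
    forall s, `|s - t| < d -> `|complex.Im (c s 0 l) - complex.Im (c t 0 l) - (s - t) * w|
      <= e * `|s - t|.
  by move=> l; apply/derivable_jet; apply: (cI l t It).2.
exists (\row_l (complex.Complex (wr l) (wi l))) => e e0.
have [K K0 HK] := inorm_le_vnorm rho.
have N0 : 0 <= N%:R :> R by [].
(* The [2] accounts for real and imaginary part, [K] for the change of norm and [1 + N] for the sum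
   over the coordinates; the added [1] avoids a zero denominator when [N = 0]. *)
pose e1 := e / (2 * K * (1 + N%:R)).
have e10 : 0 < e1 by rewrite divr_gt0 // !mulr_gt0 //; lra.
have [d d0 Hd] : exists2 d : R, 0 < d & forall l s, `|s - t| < d ->
    cabs ((c s - c t - ((s - t)%:C)%C *: (\row_l (complex.Complex (wr l) (wi l)))) 0 l)
      <= 2 * e1 * `|s - t|.
  apply: finite_radius => [l d d' /andP[_ dd'] Hd s sd|l].
    by apply: Hd; apply: lt_le_trans sd dd'.
  have [d1 d10 Hd1] := Hwr l e1 e10; have [d2 d20 Hd2] := Hwi l e1 e10.
  exists (Num.min d1 d2); first by rewrite lt_min d10.
  move=> s; rewrite lt_min => /andP[/Hd1 r1 /Hd2 r2].
  apply: le_trans (cabs_ReIm _) _; rewrite !mxE.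
  move: r1 r2; case: (c s 0 l) => x1 y1; case: (c t 0 l) => x2 y2 /=.
  by rewrite !mul0r subr0 addr0 => r1 r2; lra.
exists d => // s sd; apply: le_trans (HK _) _.
have : vnorm (c s - c t - ((s - t)%:C)%C *: (\row_l (complex.Complex (wr l) (wi l))))
    <= N%:R * (2 * e1 * `|s - t|).
  rewrite mulr_natl -[N in leRHS]card_ord -sumr_const; apply: ler_sum => l _.
  exact: Hd.
rewrite -(ler_pM2l K0) => /le_trans; apply.
have -> : e = e1 * (2 * K * (1 + N%:R)).
  by rewrite divfK // gt_eqF // !mulr_gt0 //; lra.
have -> : K * (N%:R * (2 * e1 * `|s - t|)) = (2 * K * e1 * `|s - t|) * N%:R by ring.
have -> : e1 * (2 * K * (1 + N%:R)) * `|s - t| = (2 * K * e1 * `|s - t|) * (1 + N%:R) by ring.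
apply: ler_wpM2l; last by rewrite lerDr ler01.
by apply: mulr_ge0 => //; apply: mulr_ge0; [apply: mulr_ge0 => //|]; apply: ltW.
Qed.

Lemma jet_curve_diff I c : ropen I ->
  (forall t, I t -> exists w, forall e : R, 0 < e -> exists2 d : R, 0 < d &
     forall s, I s -> `|s - t| < d ->
       inorm rho (c s - c t - ((s - t)%:C)%C *: w) <= e * `|s - t|) ->
  curve_diff I c.
Proof.
move=> Io cI l t It; have [w Hw] := cI t It; have [d1 d10 Hd1] := Io t It.
have comp e : 0 < e -> exists2 d : R, 0 < d & forall s, `|s - t| < d ->
    cabs ((c s - c t - ((s - t)%:C)%C *: w) 0 l) <= e * `|s - t|.
  move=> e0; have [d d0 Hd] := Hw e e0; exists (Num.min d d1); first by rewrite lt_min d0.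
  move=> s; rewrite lt_min => /andP[sd /Hd1 Is].
  exact: le_trans (cabs_le_inorm rho _ l) (Hd s Is sd).
split; apply/derivable_jet.
  exists (complex.Re (w 0 l)) => e /comp[d d0 Hd]; exists d => // s /Hd.
  apply: le_trans; apply: le_trans (ler_Re_cabs _); rewrite !mxE.
  case: (c s 0 l) => x1 y1; case: (c t 0 l) => x2 y2; case: (w 0 l) => x3 y3 /=.
  by rewrite mul0r subr0.
exists (complex.Im (w 0 l)) => e /comp[d d0 Hd]; exists d => // s /Hd.
apply: le_trans; apply: le_trans (ler_Im_cabs _); rewrite !mxE.
case: (c s 0 l) => x1 y1; case: (c t 0 l) => x2 y2; case: (w 0 l) => x3 y3 /=.
by rewrite mul0r addr0.
Qed.

End DifferentiableCurves.

(** * 1-flatness and first order expansions *)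

Section Flatness.

Variables (R : realType) (gT : finGroupType) (G : {group gT}) (N : nat).
Variable rho : mx_representation R[i] G N.
Variables (n : nat) (sigma : 'I_n -> cpoly R N).
Hypothesis sigma_min : min_hom_gen rho G sigma.

Implicit Types (I : set R) (c : R -> 'rV[R[i]]_n) (X Y : R -> 'rV[R[i]]_N).

Definition quotient_curve X (t : R) (w : 'rV[R[i]]_N) (s : R) : 'rV[R[i]]_N :=
  if s == t then w else (((s - t)^-1)%:C)%C *: X s.

Lemma quotient_curveE X t w s : X t = 0 -> X s = ((s - t)%:C)%C *: quotient_curve X t w s.
Proof.
move=> Xt; rewrite /quotient_curve; case: eqVneq => [->|st].
  by rewrite Xt subrr scale0r.
by rewrite scalerA -rmorphM divff ?subr_eq0 // rmorph1 scale1r.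
Qed.

(* Near [s <> t], writing [y] for the quotient at [s], the increment of the
   quotient is [(X u - X s - (u - s) y) / (u - t)]. *)
Lemma quotient_curve_continuous X t w :
  X t = 0 ->
  (forall e : R, 0 < e -> exists2 d : R, 0 < d & forall s, `|s - t| < d ->
     inorm rho (X s - ((s - t)%:C)%C *: w) <= e * `|s - t|) ->
  forall s, (forall e : R, 0 < e -> exists2 d : R, 0 < d & forall u, `|u - s| < d ->
     inorm rho (X u - X s) <= e) ->
  forall e : R, 0 < e -> exists2 d : R, 0 < d & forall u, `|u - s| < d ->
    inorm rho (quotient_curve X t w u - quotient_curve X t w s) < e.
Proof.
move=> Xt Xw s Xs e e0; set Y := quotient_curve X t w.
have YE u : X u = ((u - t)%:C)%C *: Y u by apply: quotient_curveE.
have [->|st] := eqVneq s t.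
  have e20 : 0 < e / 2 by lra.
  have [d d0 Hd] := Xw _ e20; exists d => // u ut.
  have Yt : Y t = w by rewrite /Y /quotient_curve eqxx.
  have [->|ut'] := eqVneq u t; first by rewrite subrr inorm0.
  have ut0 : 0 < `|u - t| by rewrite normr_gt0 subr_eq0.
  have := Hd u ut; rewrite YE -scalerBr inormZ mulrC ler_pM2r // Yt.
  by move=> le; apply: le_lt_trans le _; lra.
have h0 : 0 < `|s - t| by rewrite normr_gt0 subr_eq0.
set h := `|s - t| in h0; set M := inorm rho (Y s).
have M0 : 0 <= M by apply: inorm_ge0.
have M1 : 0 < 1 + M by lra.
(* Multiplied by [|u - t|], the increment is below [e h / 8 + e h / 8], while [|u - t| > h / 2]. *)
have e80 : 0 < e * h / 8 by rewrite divr_gt0 // mulr_gt0.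
have [d1 d10 Hd1] := Xs _ e80.
exists (Num.min d1 (Num.min (h / 2) (e * h / 8 / (1 + M)))).
  by rewrite !lt_min d10 !divr_gt0 // mulr_gt0.
move=> u; rewrite !lt_min => /and3P[/Hd1 ud1 ud2]; rewrite ltr_pdivlMr // => ud3.
have uh : h / 2 < `|u - t|.
  by have := ler_distD u s t; rewrite -/h (distrC s u); lra.
have ut0 : 0 < `|u - t| by lra.
rewrite -(ltr_pM2l ut0) -inormZ scalerBr -YE.
have -> : ((u - t)%:C)%C *: Y s = X s + ((u - s)%:C)%C *: Y s.
  rewrite YE -scalerDl -rmorphD /=; congr (_ *: _); congr (real_complex R _); by ring.
rewrite opprD addrA; apply: le_lt_trans (inormD _ _ _) _; rewrite inormN inormZ -/M.
have := normr_ge0 (u - s); move: (inorm rho _) `|u - s| `|u - t| ud1 ud2 ud3 uh ut0.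
move=> q p r; nra.
Qed.

Lemma lift_one_flat I c cbar t : curve_diff I cbar ->
  (forall t, I t -> polymap sigma (cbar t) = c t) -> I t -> one_flat_at rho sigma I c t.
Proof.
move=> cbar_diff cbar_lift It v vt m tau tau_min.
have [sigma_hom sigma_inv sigma_gen _] := sigma_min.
have [tau_hom _ _ _] := tau_min.
have [r r0 Hr] := luna_slice_exists sigma_min tau_min.
exists [set x | inorm rho x < r]%classic; split=> //.
have sGG : G \subset G by [].
(* The point [v] of the fibre is arbitrary, so a constant element first moves the lift to pass
   through [v] at [t]. *)
have [g Gg gv] : exists2 g, g \in G & cbar t *m rho g = v.
  by apply: (orbit_separation sGG sigma_gen); rewrite cbar_lift.
pose X s := cbar s *m rho g - v.
have Xt : X t = 0 by rewrite /X gv subrr.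
have Xjet s : I s -> exists w, forall e : R, 0 < e -> exists2 d : R, 0 < d &
    forall u, `|u - s| < d ->
      inorm rho (X u - X s - ((u - s)%:C)%C *: w) <= e * `|u - s|.
  move=> Is; have [w Hw] := curve_diff_jet rho cbar_diff Is.
  exists (w *m rho g) => e /Hw[d d0 Hd]; exists d; first exact: d0.
  move=> u /Hd.
  rewrite -(inorm_act rho _ Gg) !mulmxBl -scalemxAl /X.
  by rewrite opprB addrA subrK.
have Xcont s : I s -> forall e : R, 0 < e -> exists2 d : R, 0 < d &
    forall u, `|u - s| < d -> inorm rho (X u - X s) <= e.
  move=> Is e e0; have [w Hw] := Xjet s Is; have [d1 d10 Hd1] := Hw 1 ltr01.
  have w0 := inorm_ge0 rho w; have w1 : 0 < 1 + inorm rho w by lra.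
  exists (Num.min d1 (e / (1 + inorm rho w))); first by rewrite lt_min d10 divr_gt0.
  move=> u; rewrite lt_min => /andP[/Hd1]; rewrite mul1r ltr_pdivlMr // => le1 le2.
  have := inormD rho (X u - X s - ((u - s)%:C)%C *: w) (((u - s)%:C)%C *: w).
  rewrite subrK inormZ; move: (inorm rho _) (inorm rho _) (inorm rho _) le1 le2 => p q z.
  by move=> le1 le2; rewrite mulrDr mulr1 in le2 *; lra.
have [w Hw] := Xjet t It.
have Xw : forall e : R, 0 < e -> exists2 d : R, 0 < d & forall s, `|s - t| < d ->
    inorm rho (X s - ((s - t)%:C)%C *: w) <= e * `|s - t|.
  move=> e /Hw[d d0 Hd]; exists d; first exact: d0.
  by move=> s /Hd; rewrite Xt subr0.
pose Y := quotient_curve X t w.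
have r20 : 0 < r / 2 by lra.
have [d d0 Hd] := Xcont t It _ r20; exists d => //.
exists (fun j s => ev (tau j) (Y s)); split.
  move=> j s Is _.
  have aj : forall e : R, 0 < e -> exists2 d : R, 0 < d & forall u, `|u - s| < d ->
      cabs (ev (tau j) (Y u) - ev (tau j) (Y s)) < e.
    move=> e e0; have [d1 d10 Hd1] := @vcont_ev _ _ (Y s) (tau j) e e0.
    have [d2 d20 Hd2] := quotient_curve_continuous Xt Xw (Xcont s Is) d10.
    exists d2 => // u /Hd2 us; apply: Hd1; exact: (inorm_vclose_lt (rho := rho)).
  split; apply/continuous_for_eps => e /aj[d1 d10 Hd1]; exists d1 => // u /Hd1.
    apply: le_lt_trans; apply: le_trans (ler_Re_cabs _).
    by move: (ev _ (Y u)) (ev _ (Y s)) => [p1 q1] [p2 q2]; apply: lexx.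
  apply: le_lt_trans; apply: le_trans (ler_Im_cabs _).
  by move: (ev _ (Y u)) (ev _ (Y s)) => [p1 q1] [p2 q2]; apply: lexx.
move=> s Is sd; exists (X s).
  by apply: le_lt_trans (_ : r / 2 < r); [have := Hd s sd; rewrite Xt subr0 | lra].
split.
  by rewrite /X addrC subrK (polymap_act (H := G) sigma_inv) // cbar_lift.
apply/rowP => j; rewrite polymapE mxE.
by rewrite {1}(quotient_curveE w s Xt) ev_pdeg.
Qed.

Lemma one_flat_diff_mod I c f t : ropen I ->
  (forall t, I t -> polymap sigma (f t) = c t) -> I t -> one_flat_at rho sigma I c t ->
  exists w, forall e : R, 0 < e -> exists2 d : R, 0 < d &
    forall s, I s -> `|s - t| < d -> exists2 g, g \in G &
      inorm rho (f s *m rho g - f t - ((s - t)%:C)%C *: w) <= e * `|s - t|.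
Proof.
move=> Io fc It flat; have [_ _ sigma_gen _] := sigma_min.
have sGG : G \subset G by [].
set v := f t; pose K := isotropy_group rho v; have sKG : K \subset G := isotropy_sub rho v.
have [m [tau tau_min]] := min_hom_gen_exists rho sKG.
have [tau_hom _ tau_gen _] := tau_min.
have [S [_ [d d0 [a [a_cont aP]]]]] := flat v (fc t It) m tau tau_min.
pose A s : 'rV[R[i]]_m := \row_j a j s.
have tt : `|t - t| < d by rewrite subrr normr0.
have A_cont e : 0 < e -> exists2 d : R, 0 < d &
    forall s, `|s - t| < d -> vclose e (A s) (A t).
  move=> e0; have e20 : 0 < e / 2 by lra.
  have [d1 d10 Hd1] : exists2 d : R, 0 < d & forall j s, `|s - t| < d ->
      cabs (a j s - a j t) < e.
    apply: finite_radius => [j d1 d1' /andP[_ dd'] H1 s sd|j].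
      by apply: H1; apply: lt_le_trans sd dd'.
    have [/continuous_for_eps/(_ _ e20)[d1 d10 Hd1]] := a_cont j t It tt.
    move=> /continuous_for_eps/(_ _ e20)[d2 d20 Hd2].
    exists (Num.min d1 d2); first by rewrite lt_min d10.
    move=> s; rewrite lt_min => /andP[/Hd1 s1 /Hd2 s2].
    apply: le_lt_trans (cabs_ReIm _) _.
    by move: s1 s2; case: (a j s) => ? ?; case: (a j t) => ? ? /=; lra.
  by exists d1 => // s sd j; rewrite !mxE; apply: Hd1.
(* By homogeneity, dividing [x] by [s - t] cancels the powers in the normal form. *)
have quot s : I s -> `|s - t| < d -> s != t -> exists y,
    polymap tau y = A s /\ polymap sigma (v + ((s - t)%:C)%C *: y) = c s.
  move=> Is sd st; have [x _ [sx tx]] := aP s Is sd.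
  have st0 : ((s - t)%:C)%C != 0 :> R[i] by rewrite fmorph_eq0 subr_eq0.
  exists (((s - t)%:C)%C^-1 *: x); split; last by rewrite scalerA divff // scale1r.
  apply/rowP => j; rewrite polymapE ev_pdeg // -polymapE tx !mxE mulrA.
  by rewrite -exprMn mulVf // expr1n mul1r.
(* The limit [A t] is approached by values of [tau] at the parameters [t + h]; halving the minimum
   keeps [h] nonzero and strictly inside all radii. *)
have [w Hw] : exists w, polymap tau w = A t.
  apply: (polymap_closed (H := K) sKG tau_min) => e /A_cont[d1 d10 Hd1].
  have [d2 d20 Hd2] := Io t It.
  pose h := Num.min d (Num.min d1 d2) / 2.
  have h0 : 0 < Num.min d (Num.min d1 d2) by rewrite !lt_min d0 d10.
  have hE : `|t + h - t| < Num.min d (Num.min d1 d2).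
    by rewrite addrC addKr gtr0_norm /h; lra.
  move: hE; rewrite !lt_min => /and3P[h1 h2 h3].
  have [|y [yA _]] := quot (t + h) (Hd2 _ h3) h1; last by exists y; rewrite yA; apply: Hd1.
  by rewrite -subr_eq0 addrC addKr gt_eqF // /h; lra.
exists w => e e0.
have [d1 d10 Hd1] := orbit_close (H := K) sKG tau_gen w e0.
have [d2 d20 Hd2] := A_cont _ d10.
exists (Num.min d d2); first by rewrite lt_min d0.
move=> s Is; rewrite lt_min => /andP[sd sd2].
have [->|st] := eqVneq s t.
  by exists 1%g => //; rewrite repr_act1 !subrr scale0r subrr inorm0 normr0 mulr0.
have [y [yA yc]] := quot s Is sd st.
have [|k Kk kw] := Hd1 y; first by rewrite yA Hw; apply: Hd2.
have [Gk vk] : k \in G /\ v *m rho k = v.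
  by move: Kk; rewrite inE => /andP[Gk /eqP].
(* [h] brings [f s] to [v + (s - t) y]; then [k] fixes [v] and brings [y] near [w]. *)
have [h Gh hE] : exists2 h, h \in G & f s *m rho h = v + ((s - t)%:C)%C *: y.
  by apply: (orbit_separation sGG sigma_gen); rewrite yc fc.
exists (h * k)%g; first by rewrite groupM.
rewrite -repr_actM // hE mulmxDl vk -scalemxAl [v + _]addrC addrK -scalerBr inormZ mulrC.
by rewrite ler_wpM2r // ltW.
Qed.

End Flatness.

Theorem theorem6p4 (R : realType) (gT : finGroupType) (G : {group gT})
  (N : nat) (rho : mx_representation R[i] G N)
  (n : nat) (sigma : 'I_n -> cpoly R N) (hsigma : min_hom_gen rho G sigma)
  (D : nat) (hD : is_D rho D)
  (a b : \bar R) (c : R -> 'rV[R[i]]_n)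
  (hcV : forall t, oitv a b t -> exists x, polymap sigma x = c t)
  (hcD : curve_Ck (oitv a b) D c) :
  (exists cbar : R -> 'rV[R[i]]_N,
     curve_diff (oitv a b) cbar /\
     forall t, oitv a b t -> polymap sigma (cbar t) = c t)
  <-> (forall t, oitv a b t -> one_flat_at rho sigma (oitv a b) c t).
Proof.
split=> [[cbar [cbar_diff cbar_lift]] t It | flat].
  exact: (lift_one_flat hsigma cbar_diff cbar_lift It).
(* A pointwise choice of preimages, with the default [0] outside the interval. *)
have [f Hf] : {f : R -> 'rV[R[i]]_N & forall t, oitv a b t -> polymap sigma (f t) = c t}.
  apply: (@choice _ _ (fun t x => oitv a b t -> polymap sigma x = c t)) => t.
  have [/hcV[x xt]|nIt] := pselect (oitv a b t); first by exists x.
  by exists 0 => /nIt.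
have [F [F_lift F_diff]] := diff_lift_inorm (@oitv_interval R a b) (@oitv_open R a b)
  (fun t It => one_flat_diff_mod hsigma (@oitv_open R a b) Hf It (flat t It)).
exists F; split; first exact: (jet_curve_diff (@oitv_open R a b) F_diff).
move=> t It; have [_ sigma_inv _ _] := hsigma; have [g Gg ->] := F_lift t It.
by rewrite (polymap_act (H := G) sigma_inv) // Hf.
Qed.
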